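(* Let $W_\infty\in\mathcal W_v$ satisfy $W_\infty>0$ Lebesgue-a.e. and $\mathcal V[W_\infty](x)=1$ for Lebesgue-a.e. $x\in[0,1]$. For $\boldsymbol\alpha,\boldsymbol h\in\mathbb R^c$ consider the optimization problem $$\sup_{\boldsymbol f\in\mathcal F_c}\left\{\sum_{r=1}^c\alpha_rG_{W_\infty,\mathbf 1_r}(\boldsymbol f)+\sum_{r=1}^c h_r\int_0^1 f_r(u)\,du-\int_0^1\sum_{r=1}^c f_r(u)\log f_r(u)\,du\right\}-\log c.\qquad(\ast)$$ Then the following hold. (i) For any $\boldsymbol h\in\mathbb R^c$, define $\tilde h:=\max_{1\le r\le c}h_r-h_1$. Then there exists $\eta=\eta(c,v,\tilde h)>0$ such that for any $\boldsymbol\alpha=(\alpha_1,\ldots,\alpha_c)$ with $\alpha_1,\ldots,\alpha_c\ge0$ and $\alpha_1\ge\eta+\max_{2\le r\le c}\alpha_r$, the problem $(\ast)$ has a unique maximizer. Furthermore, denoting this maximizer by $(x_{\boldsymbol\alpha,\boldsymbol h,1},\ldots,x_{\boldsymbol\alpha,\boldsymbol h,c})$, we have $x_{\boldsymbol\alpha,\boldsymbol h,1}>\max_{2\le r\le c}x_{\boldsymbol\alpha,\boldsymbol h,r}$, and the map $(\boldsymbol\alpha,\boldsymbol h)\mapsto(x_{\boldsymbol\alpha,\boldsymbol h,1},\ldots,x_{\boldsymbol\alpha,\boldsymbol h,c})$ (defined on the set of such pairs) is continuous. (ii) For any $\boldsymbol\alpha\in\mathbb R_{\ge0}^c$, define $\widetilde\alpha:=\max_{1\le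 r\le c}\alpha_r-\alpha_1$. Then there exists $\eta=\eta(c,v,\widetilde\alpha)>0$ such that for any $\boldsymbol h=(h_1,\ldots,h_c)$ with $h_1\ge\eta+\max_{2\le r\le c}h_r$, the problem $(\ast)$ has a unique maximizer. Furthermore, denoting this maximizer by $(x_{\boldsymbol\alpha,\boldsymbol h,1},\ldots,x_{\boldsymbol\alpha,\boldsymbol h,c})$, we have $x_{\boldsymbol\alpha,\boldsymbol h,1}>\max_{2\le r\le c}x_{\boldsymbol\alpha,\boldsymbol h,r}$, and the map $(\boldsymbol\alpha,\boldsymbol h)\mapsto(x_{\boldsymbol\alpha,\boldsymbol h,1},\ldots,x_{\boldsymbol\alpha,\boldsymbol h,c})$ (defined on the set of such pairs) is continuous. (iii) Assume $0\le\alpha_r\le\frac1{v(v-1)}$ for all $r\in[c]$, and $\boldsymbol h\in\mathbb R^c$. Then the maximizer of $(\ast)$ is unique.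
   Context: Integers $c,v\ge2$ are fixed and $[m]:=\{1,\ldots,m\}$. $\mathcal W_v$ is the space of symmetric real-valued functions in $L^1([0,1]^v)$. $\mathcal F_c$ is the set of measurable $\boldsymbol f=(f_1,\ldots,f_c):[0,1]\to[0,1]^c$ with $\sum_{r=1}^c f_r(x)=1$ for all $x$ (modulo a.e. equality). For $W\in\mathcal W_v$, $$G_{W,\mathbf 1_r}(\boldsymbol f):=\int_{[0,1]^v}W(x_1,\ldots,x_v)\prod_{a=1}^v f_r(x_a)\,dx_1\cdots dx_v,\qquad\mathcal V[W](x):=\int_{[0,1]^{v-1}}W(x,x_2,\ldots,x_v)\prod_{a=2}^v dx_a.$$ Under these hypotheses on $W_\infty$ and for $\boldsymbol\alpha\in\mathbb R^c_{\ge0}$, all maximizers of $(\ast)$ over $\mathcal F_c$ are a.e. constant, and an a.e. constant $\boldsymbol f\equiv(x_1,\ldots,x_c)$ is identified with the probability vector $(x_1,\ldots,x_c)$. Convention: $0\log0=0$. *)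

(* Defs.v *)
From HB Require Import structures.
From mathcomp Require Import all_boot all_order all_algebra.
From mathcomp Require Import all_fingroup.
From mathcomp Require Import all_classical all_reals all_analysis.

Set Implicit Arguments.
Unset Strict Implicit.
Unset Printing Implicit Defensive.

Import Order.TTheory GRing.Theory Num.Theory.
Import numFieldNormedType.Exports.

Local Open Scope classical_set_scope.
Local Open Scope ring_scope.

(** Lebesgue measure on R^n (the type of n-tuples of reals), obtained from
    R^(n.+1) = R x R^n by transporting the binary product measure along
    (x, t) |-> x :: t. *)
Section cons_measure.
Context d (T : measurableType d) (R : realType) (n : nat).
Variable m1 : {sigma_finite_measure set T -> \bar R}.
Variable m2 : {sigma_finite_measure set (n.-tuple T) -> \bar R}.

Definition tcons (p : T * n.-tuple T) : n.+1.-tuple T := [tuple of p.1 :: p.2].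

Lemma measurable_tcons : measurable_fun [set: T * n.-tuple T] tcons.
Proof. exact: (measurable_cons measurable_fst measurable_snd). Qed.

Definition cons_measure : set (n.+1.-tuple T) -> \bar R :=
  pushforward (m1 \x m2)%E tcons.

Let cons_measure0 : cons_measure set0 = 0%E.
Proof. by rewrite /cons_measure /pushforward preimage_set0 measure0. Qed.

Let cons_measure_ge0 A : (0 <= cons_measure A)%E.
Proof. exact: (measure_ge0 (m1 \x m2)%E). Qed.

Let cons_measure_sigma_additive : semi_sigma_additive cons_measure.
Proof.
move=> F mF tF mUF; rewrite /cons_measure /pushforward preimage_bigcup.
apply: measure_semi_sigma_additive.
- by move=> k; rewrite -[X in measurable X]setTI; exact: measurable_tcons.
- apply/trivIsetP => /= i j _ _ ij; rewrite -preimage_setI.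
  by move/trivIsetP : tF => /(_ _ _ _ _ ij) ->//; rewrite preimage_set0.
- rewrite -preimage_bigcup -[X in measurable X]setTI.
  exact: measurable_tcons.
Qed.

HB.instance Definition _ := isMeasure.Build _ _ _
  cons_measure cons_measure0 cons_measure_ge0 cons_measure_sigma_additive.

Let cons_measure_sigma_finite : sigma_finite setT cons_measure.
Proof.
have /sigma_finiteP[F [TF ndF Foo]] := sigma_finiteT m1.
have /sigma_finiteP[H [TH ndH Hoo]] := sigma_finiteT m2.
exists (fun k => [set t | F k (thead t) /\ H k [tuple of behead t]]).
  apply/seteqP; split=> // t _.
  have [i _ Fi] : (\bigcup_i F i) (thead t) by rewrite -TF.
  have [j _ Hj] : (\bigcup_j H j) [tuple of behead t] by rewrite -TH.
  exists (maxn i j) => //=; split.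
    by move: Fi; exact/subsetPset/ndF/leq_maxl.
  by move: Hj; exact/subsetPset/ndH/leq_maxr.
move=> k; have [mF Fk] := Foo k; have [mH Hk] := Hoo k; split.
  rewrite [X in measurable X](_ : _ = (tnth (T:=T) ^~ ord0) @^-1` F k `&`
    (fun t : n.+1.-tuple T => [tuple of behead t]) @^-1` H k)//.
  apply: measurableI; rewrite -[X in measurable X]setTI.
    exact: measurable_tnth.
  exact: measurable_behead.
rewrite /cons_measure /pushforward [X in (_ \x _)%E X](_ : _ = F k `*` H k).
  by rewrite product_measure1E// lte_mul_pinfty// ge0_fin_numE.
have tbehead x (t : n.-tuple T) : [tuple of behead (tcons (x, t))] = t.
  exact: val_inj.
by apply/seteqP; split=> -[x t] /=; rewrite theadE tbehead.
Qed.

HB.instance Definition _ := Measure_isSigmaFinite.Build _ _ _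
  cons_measure cons_measure_sigma_finite.

End cons_measure.

Fixpoint lebesgue_power (R : realType) (n : nat) :
    {sigma_finite_measure set (n.-tuple (measurableTypeR R)) -> \bar R} :=
  match n with
  | 0 => dirac [tuple] : {sigma_finite_measure set _ -> \bar R}
  | m.+1 => cons_measure (@lebesgue_measure R) (lebesgue_power R m)
  end.

Lemma lebesgue_power_box (R : realType) (n : nat)
    (A : 'I_n -> set (measurableTypeR R)) : (forall i, measurable (A i)) ->
  lebesgue_power R n [set t | forall i, A i (tnth t i)] =
  (\prod_(i < n) lebesgue_measure (A i))%E.
Proof.
elim: n A => [|n IHn] A mA.
  rewrite big_ord0 /= diracE mem_set//= => -[].
  by [].
rewrite big_ord_recl /= -IHn; last by move=> i; exact: mA.
rewrite /cons_measure /pushforward.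
have -> : tcons (n:=n) @^-1` [set t | forall i, A i (tnth t i)] =
    A ord0 `*` [set t | forall i, A (lift ord0 i) (tnth t i)].
  apply/seteqP; split=> [[x t] /= H|[x t] /= [H0 H] i].
    split; first exact: (H ord0).
    by move=> i; have := H (lift ord0 i); rewrite tnthS.
  by case: (unliftP ord0 i) => [j ->|->//]; rewrite tnthS.
rewrite product_measure1E//.
rewrite [X in measurable X](_ : _ = \bigcap_(i in [set: 'I_n])
   ((@tnth n (measurableTypeR R) ^~ i) @^-1` A (lift ord0 i))); last first.
  by apply/seteqP; split=> [t /= H i _|t /= H i]; [exact: H|exact: (H i I)].
apply: fin_bigcap_measurable => // i _.
rewrite -[X in measurable X]setTI; exact: measurable_tnth.
Qed.

(** Functions on [0,1] and [0,1]^v are represented by functions on R and R^v whose values outside of the cube are irrelevant.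
    Measurability is Borel measurability: as everything is taken modulo a.e.
    equality, this describes the same classes as Lebesgue measurability. *)
Section model.
Variables (R : realType) (c v : nat).

Local Notation mu := (@lebesgue_measure R).
Local Notation realv n := (n.-tuple (measurableTypeR R)).

Definition unit_itv : set (measurableTypeR R) := `[0%R, 1%R].

Definition cube n : set (realv n) := [set t | forall i, unit_itv (tnth t i)].

Definition permute_args (s : 'S_v) (t : realv v) : realv v :=
  [tuple tnth t (s i) | i < v].

(** [W_v]: elements of L^1 are classes modulo a.e. equality, hence symmetry is
    required almost everywhere. *)
Definition symmetric_L1 (W : realv v -> R) : Prop :=
  (lebesgue_power R v).-integrable (cube (n:=v)) (EFin \o W) /\
  forall s : 'S_v,
    {ae lebesgue_power R v, forall t, cube t -> W (permute_args s t) = W t}.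

(** [F_c], with f_r(x) written [f x 0 r]. *)
Definition color_fun (f : R -> 'rV[R]_c) : Prop :=
  [/\ forall r, measurable_fun unit_itv (fun x => f x 0 r),
      forall x, unit_itv x -> forall r, 0 <= f x 0 r <= 1
    & forall x, unit_itv x -> \sum_(r < c) f x 0 r = 1].

Definition G (W : realv v -> R) (r : 'I_c) (f : R -> 'rV[R]_c) : R :=
  \int[lebesgue_power R v]_(t in cube (n:=v))
    (W t * \prod_(a < v) f (tnth t a) 0 r).

(** For 0 < v, [nth 0 (x :: t) a] for a < v enumerates (x, x_2, ..., x_v). *)
Definition Vop (W : realv v -> R) (x : R) : R :=
  \int[lebesgue_power R v.-1]_(t in cube (n:=v.-1))
    W [tuple nth 0 (x :: t) a | a < v].

(** [ln 0 = 0] in the library, so the convention 0 log 0 = 0 holds. *)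
Definition objective (W : realv v -> R) (alpha h : 'rV[R]_c)
    (f : R -> 'rV[R]_c) : R :=
  \sum_(r < c) alpha 0 r * G W r f
  + \sum_(r < c) h 0 r * \int[mu]_(u in unit_itv) f u 0 r
  - \int[mu]_(u in unit_itv) (\sum_(r < c) f u 0 r * ln (f u 0 r)).

Definition problem_value (W : realv v -> R) (alpha h : 'rV[R]_c) : \bar R :=
  (ereal_sup [set (objective W alpha h f)%:E | f in color_fun]
   - (ln c%:R)%:E)%E.

Definition maximizer (W : realv v -> R) (alpha h : 'rV[R]_c)
    (f : R -> 'rV[R]_c) : Prop :=
  color_fun f /\
  (objective W alpha h f - ln c%:R)%:E = problem_value W alpha h.

Definition unique_maximizer (W : realv v -> R) (alpha h : 'rV[R]_c)
    (f : R -> 'rV[R]_c) : Prop :=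
  maximizer W alpha h f /\
  forall g, maximizer W alpha h g ->
    {ae mu, forall u, unit_itv u -> g u = f u}.

Definition regular_kernel (W : realv v -> R) : Prop :=
  [/\ symmetric_L1 W,
      {ae lebesgue_power R v, forall t, cube t -> 0 < W t}
    & {ae mu, forall x, unit_itv x -> Vop W x = 1}].

End model.

(** With 'I_c = {0, ..., c-1}, the colours 1 and 2 are the ordinals 0 and 1. *)
Definition color1 (c : nat) (hc : (2 <= c)%N) : 'I_c := Ordinal (ltnW hc).
Definition color2 (c : nat) (hc : (2 <= c)%N) : 'I_c := Ordinal hc.

(** The default values of the two iterated maxima belong to their ranges. *)
Definition max_all (R : realType) (c : nat) (hc : (2 <= c)%N)
    (x : 'rV[R]_c) : R :=
  \big[Num.max/x 0 (color1 hc)]_(r < c) x 0 r.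

Definition max_rest (R : realType) (c : nat) (hc : (2 <= c)%N)
    (x : 'rV[R]_c) : R :=
  \big[Num.max/x 0 (color2 hc)]_(r < c | r != color1 hc) x 0 r.

(** Pairs (alpha, h) whose first coordinate dominates in alpha (resp. in h) by
    the threshold eta, which depends on h (resp. alpha) only through
    max_r h_r - h_1 (resp. max_r alpha_r - alpha_1). *)
Definition domain_alpha (R : realType) (c : nat) (hc : (2 <= c)%N)
    (eta : R -> R) : set ('rV[R]_c * 'rV[R]_c) :=
  [set p : 'rV[R]_c * 'rV[R]_c | (forall r, 0 <= p.1 0 r) /\
    p.1 0 (color1 hc) >=
      eta (max_all hc p.2 - p.2 0 (color1 hc)) + max_rest hc p.1].

Definition domain_h (R : realType) (c : nat) (hc : (2 <= c)%N)
    (eta : R -> R) : set ('rV[R]_c * 'rV[R]_c) :=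
  [set p : 'rV[R]_c * 'rV[R]_c | (forall r, 0 <= p.1 0 r) /\
    p.2 0 (color1 hc) >=
      eta (max_all hc p.1 - p.1 0 (color1 hc)) + max_rest hc p.2].

(** On D, the problem has a unique maximizer, it is (a.e. equal to) the constant
    x_(alpha, h), whose first coordinate strictly dominates the others, and
    x is continuous on D for the subspace topology. *)
Definition dominant_continuous_maximizer (R : realType) (c v : nat)
    (hc : (2 <= c)%N) (W : v.-tuple (measurableTypeR R) -> R)
    (D : set ('rV[R]_c * 'rV[R]_c)) : Prop :=
  exists x : 'rV[R]_c * 'rV[R]_c -> 'rV[R]_c,
    (forall p, D p ->
      unique_maximizer W p.1 p.2 (cst (x p)) /\
      x p 0 (color1 hc) > max_rest hc (x p)) /\
    {within D, continuous x}.

(* Main.v *)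
Require Import Defs.
From HB Require Import structures.
From mathcomp Require Import all_boot all_order all_algebra all_fingroup.
From mathcomp Require Import all_classical all_reals all_analysis.
From mathcomp Require Import measurable_realfun ring lra.

Set Implicit Arguments.
Unset Strict Implicit.
Unset Printing Implicit Defensive.

Import Order.TTheory GRing.Theory Num.Theory.
Import numFieldNormedType.Exports.

Local Open Scope classical_set_scope.
Local Open Scope ring_scope.

(** By AM-GM, [prod_a f_r(x_a) <= v^-1 sum_a f_r(x_a)^v]; integrating against
    the symmetric kernel [W], whose one-dimensional marginal is 1, gives
    [G W r f <= int f_r^v]. Hence the objective at [f] is at most
    [int Phi(f(u)) du], where
    [Phi(x) = sum_r (alpha_r x_r^v + h_r x_r - x_r ln x_r)], with equality when
    [f] is constant. So the supremum is [max Phi] over the simplex, and if [Phi]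
    has a unique maximizer [x], any optimal [f] satisfies [Phi(f(u)) = max Phi],
    i.e. [f(u) = x], almost everywhere.

    Maximizers of [Phi] are interior, because the entropy has infinite slope at
    the boundary, and the partial derivatives of [Phi] at a maximizer are all
    equal to one multiplier. If each [alpha_r <= 1/(v(v-1))], these partial
    derivatives are strictly decreasing, so two maximizers with ordered
    multipliers are ordered coordinatewise, and they agree since their
    coordinates have the same sum.

    When colour [k] dominates, comparison with the vertex [e_k] forces [x_k]
    close to 1, and stationarity then forces the other coordinates below some
    [delta] which is exponentially small in [alpha_k]. On that region [Phi] is
    very concave in the coordinates [r <> k], which beats the convexity in the
    coordinate [k]. Continuity of the maximizer is the usual consequence of
    uniqueness and compactness of the simplex. *)

(** * Permutation invariance and the marginal of the kernel *)

Section perm.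
Context {R : realType}.
Local Notation mu := (@lebesgue_measure R).
Local Notation realv n := (n.-tuple (measurableTypeR R)).

Definition box v (A : 'I_v -> set (measurableTypeR R)) : set (realv v) :=
  [set t | forall i, A i (tnth t i)].

Lemma boxE v (A : 'I_v -> set (measurableTypeR R)) :
  box A = \bigcap_(i in [set: 'I_v]) ((fun t : realv v => tnth t i) @^-1` A i).
Proof. by apply/seteqP; split=> [t H i _|t H i]; [exact: H|exact: (H i I)]. Qed.

Lemma measurable_box v (A : 'I_v -> set (measurableTypeR R)) :
  (forall i, measurable (A i)) -> measurable (box A).
Proof.
move=> mA; rewrite boxE; apply: fin_bigcap_measurable => // i _.
rewrite -[X in measurable X]setTI; exact: measurable_tnth.
Qed.

(** The sigma-algebra on tuples is generated by preimages under single coordinates, i.e. boxes with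
    at most one side other than [setT]. General boxes are moreover stable under intersection, as
    uniqueness of measures requires. *)
Lemma measurable_tuple_generated_by_boxes v :
  @measurable _ (realv v) =
  <<s [set box A | A in [set A | forall i, measurable (A i)]] >>.
Proof.
apply/seteqP; split.
  apply: smallest_sub => [|B].
    exact: smallest_sigma_algebra.
  rewrite -bigcup_seq => -[i _] [C mC <-]; apply: sub_sigma_algebra.
  exists (fun j => if j == i then C else setT) => [j|]; first by case: eqP.
  rewrite setTI; apply/seteqP; split=> t /=.
    by move/(_ i); rewrite eqxx.
  by move=> Ct j; case: eqP => // ->.
apply: smallest_sub; first exact: sigma_algebra_measurable.
by move=> _ [A mA <-]; exact: measurable_box.
Qed.

Lemma measurable_permute_args v (s : 'S_v) :
  measurable_fun [set: realv v] (@permute_args R v s).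
Proof.
apply/measurable_fun_tnthP => i.
rewrite (_ : _ \o _ = fun t => tnth t (s i)); first exact: measurable_tnth.
by apply/funext => t /=; rewrite tnth_mktuple.
Qed.

(** Both measures give a box the product of the lengths of its sides, in whatever order. Boxes form
    a generating pi-system, and the boxes [g k] of finite measure exhaust the space, so the measures
    coincide. *)
Lemma lebesgue_power_permute v (s : 'S_v) (A : set (realv v)) : measurable A ->
  lebesgue_power R v (@permute_args R v s @^-1` A) = lebesgue_power R v A.
Proof.
move=> mA.
pose m := pushforward (lebesgue_power R v) (@permute_args R v s).
pose G := [set box A | A in [set A : 'I_v -> set (measurableTypeR R) | forall i, measurable (A i)]].
pose g (k : nat) := box (fun _ : 'I_v => `[- (k%:R : R), k%:R]%classic : set (measurableTypeR R)).
have mb B : G B -> lebesgue_power R v B = m B.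
  move=> [C mC <-]; rewrite /m /pushforward.
  rewrite (_ : _ @^-1` _ = box (fun i => C ((s^-1)%g i))); last first.
    apply/seteqP; split=> t /= H i.
      by have := H ((s^-1)%g i); rewrite tnth_mktuple permKV.
    by rewrite tnth_mktuple; have := H (s i); rewrite permK.
  rewrite !lebesgue_power_box// [RHS](reindex_inj (@perm_inj _ s)) /=.
  by apply: eq_bigr => i _; rewrite permK.
rewrite -/(m A); apply/esym.

have mphi := measurable_permute_args s.
apply: (@measure_unique _ R (realv v) G g _ _ _ _ (lebesgue_power R v)
  (pushforward (lebesgue_power R v) (@permute_args R v s))) => //.

- exact: measurable_tuple_generated_by_boxes.
- move=> _ _ [B mB <-] [C mC <-]; exists (fun i => B i `&` C i) => [i|].
    exact: measurableI.
  by apply/seteqP; split=> t /= => [H|[H1 H2] i]; [split=> i; case: (H i)|split].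
- by move=> k; exists (fun=> `[- (k%:R : R), k%:R]%classic).
- apply/seteqP; split=> // t _; exists (\max_(i < v) Num.bound (`|(tnth t i : R)|%R))%N => //.
  move=> i; rewrite /= in_itv /= -ler_norml; apply: ltW.
  apply: (lt_le_trans (archi_boundP (normr_ge0 _))).
  by rewrite ler_nat; exact: (leq_bigmax (F := fun i => Num.bound (`|(tnth t i : R)|%R))).
- move=> k; pose B (_ : 'I_v) := `[- (k%:R : R), k%:R]%classic : set (measurableTypeR R).
  change (lebesgue_power R v (g k) < +oo)%E.
  rewrite (_ : lebesgue_power R v (g k) = (\prod_(i < v) mu (B i))%E); last first.
    exact: lebesgue_power_box.
  rewrite ltey_eq; apply/orP; left; apply: prode_fin_num => i _.
  by rewrite lebesgue_measure_itv /=; case: ifP.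
Qed.

Lemma cubeE n : @cube R n = box (fun=> @unit_itv R).
Proof. by []. Qed.

Lemma measurable_cube n : measurable (@cube R n).
Proof.
rewrite cubeE; apply: measurable_box => _; exact: measurable_itv.
Qed.

Lemma cube_permute_args v (s : 'S_v) (t : realv v) :
  cube (permute_args s t) <-> cube t.
Proof.
split=> H i; last by rewrite tnth_mktuple; exact: H.
by have := H ((s^-1)%g i); rewrite tnth_mktuple permKV.
Qed.

Lemma restrict_permute_args v (s : 'S_v) (f : realv v -> \bar R) :
  (f \o @permute_args R v s) \_ (@cube R v) = (f \_ (@cube R v)) \o @permute_args R v s.
Proof.
apply/funext => t; rewrite /= !patchE.
suff -> : (permute_args s t \in @cube R v) = (t \in @cube R v) by [].
by apply/idP/idP; rewrite !inE => /cube_permute_args.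
Qed.

Lemma integral_lebesgue_power_permute v (s : 'S_v) (f : realv v -> \bar R) :
  measurable_fun [set: realv v] f -> (forall t, 0 <= f t)%E ->
  (\int[lebesgue_power R v]_t f (permute_args s t) =
   \int[lebesgue_power R v]_t f t)%E.
Proof.
move=> mf f0; have mphi := measurable_permute_args s.
rewrite -[LHS](ge0_integral_pushforward mphi (lebesgue_power R v) measurableT mf) //.
by apply: eq_measure_integral => A mA _; exact: lebesgue_power_permute.
Qed.

Lemma integrable_permute v (s : 'S_v) (f : realv v -> \bar R) :
  (lebesgue_power R v).-integrable (@cube R v) f ->
  (lebesgue_power R v).-integrable (@cube R v) (f \o @permute_args R v s).
Proof.
have mphi := measurable_permute_args s.
move=> /(integrable_mkcond f (@measurable_cube v)) /integrableP[mf foo].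
apply/(integrable_mkcond _ (@measurable_cube v)).
rewrite restrict_permute_args; apply/integrableP; split.
  exact: measurableT_comp.
rewrite (integral_lebesgue_power_permute s (f := abse \o (f \_ (@cube R v)))) //.
  exact: measurableT_comp.
by move=> t /=.
Qed.

Lemma integral_permute v (s : 'S_v) (f : realv v -> \bar R) :
  (lebesgue_power R v).-integrable (@cube R v) f ->
  (\int[lebesgue_power R v]_(t in @cube R v) f (permute_args s t) =
   \int[lebesgue_power R v]_(t in @cube R v) f t)%E.
Proof.
move=> intf; have mphi := measurable_permute_args s.
have iF := (integrable_mkcond _ (@measurable_cube v)).1 intf.
have iFs := (integrable_mkcond _ (@measurable_cube v)).1 (integrable_permute s intf).
rewrite !(integral_mkcond (@cube R v)) restrict_permute_args.
rewrite restrict_permute_args in iFs.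
have mF := measurable_int _ iF.
rewrite -[LHS](integral_pushforward mphi mF (D := setT)) //.
by apply: eq_measure_integral => A mA _; exact: lebesgue_power_permute.
Qed.

(** Fubini along [tcons]: for almost every [x] the inner integral is [g x * Vop W x = g x]. *)
Lemma integral_cube_first n (W : realv n.+1 -> R) (g : R -> R) :
  (lebesgue_power R n.+1).-integrable (@cube R n.+1) (EFin \o W) ->
  {ae mu, forall x, @unit_itv R x -> Vop W x = 1} ->
  measurable_fun (@unit_itv R) g -> (forall x, @unit_itv R x -> 0 <= g x <= 1) ->
  (lebesgue_power R n.+1).-integrable (@cube R n.+1)
      (fun t => (W t * g (tnth t ord0))%:E) /\
  (\int[lebesgue_power R n.+1]_(t in @cube R n.+1) (W t * g (tnth t ord0))%:E =
   \int[mu]_(x in @unit_itv R) (g x)%:E)%E.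
Proof.
move=> iW V1 mg g01.
have mI : measurable (@unit_itv R) by exact: measurable_itv.
have mC := @measurable_cube n.+1; have mCn := @measurable_cube n.
have ih : (lebesgue_power R n.+1).-integrable (@cube R n.+1)
      (fun t => (W t * g (tnth t ord0))%:E).
  apply: (@integrableMl _ _ _ (lebesgue_power R n.+1) _ mC (EFin \o W) (fun t => g (tnth t ord0))) => //.
    apply: (measurable_comp mI) => //; last first.
      apply: measurable_funTS; exact: measurable_tnth.
    by move=> _ [t Ct <-]; exact: Ct.
  exists 1; split => // M M1 t Ct; rewrite /= ger0_norm; last by case/andP: (g01 _ (Ct ord0)).
  by case/andP: (g01 _ (Ct ord0)) => _ /le_trans; apply; exact: ltW.
split => //.
have mtc := @measurable_tcons _ (measurableTypeR R) n.
(* [lebesgue_power R n.+1] is by definition the pushforward of the product measure along [tcons]. *)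
have transfer (f : realv n.+1 -> \bar R) :
    (lebesgue_power R n.+1).-integrable [set: realv n.+1] f ->
    ((mu \x lebesgue_power R n)%E).-integrable setT (f \o tcons (n := n)) /\
    (\int[lebesgue_power R n.+1]_t f t =
     \int[(mu \x lebesgue_power R n)%E]_p f (tcons p))%E.
  move=> /integrableP[mf foo].
  have i2 : ((mu \x lebesgue_power R n)%E).-integrable setT (f \o tcons (n := n)).
    apply/integrableP; split; first exact: measurableT_comp.
    have mabs : measurable_fun setT (abse \o f) by exact: measurableT_comp.
    rewrite -[ltLHS](ge0_integral_pushforward mtc _ measurableT mabs) //.
    by move=> ? _ /=.
  split => //.
  by rewrite -[RHS](integral_pushforward mtc mf (D := setT)).
have [iWc _] := transfer _ ((integrable_mkcond _ mC).1 iW).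
have [ihc] := transfer _ ((integrable_mkcond _ mC).1 ih).
rewrite -integral_mkcond => ->.
rewrite -(integral12_prod_meas1 ihc) [RHS]integral_mkcond.
have mgr : measurable_fun setT ((fun x => (g x)%:E) \_ (@unit_itv R)).
  by apply/(measurable_restrictT _ mI)/measurable_EFinP.
apply: ae_eq_integral => //.
  exact: (measurable_fubini_F ihc).
(* Almost every slice of [W] is integrable. This lets [g x] leave the inner integral, and ensures
   that [Vop W x], a real number obtained through [fine], is the actual extended integral. *)
have := ae_integrable1 iWc.
move: V1; apply: filterS2 => x V1 iWx _.
rewrite /fubini_F patchE.
have tcube t : (tcons (x, t) \in @cube R n.+1) = (x \in @unit_itv R) && (t \in @cube R n).
  apply/idP/andP; rewrite !inE.
    move=> H; split; first exact: (H ord0).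
    by move=> i; have := H (lift ord0 i); rewrite tnthS.
  by move=> [Ix Ct] i; case: (unliftP ord0 i) => [j ->|->//]; rewrite tnthS; exact: Ct.
case: ifPn => xI; last first.
  by rewrite integral0_eq // => t _ /=; rewrite patchE tcube (negbTE xI).
have Wx t : ((EFin \o W) \_ (@cube R n.+1)) (tcons (x, t)) =
     ((fun t => (W (tcons (x, t)))%:E) \_ (@cube R n)) t.
  by rewrite /= !patchE tcube xI.
have {}iWx : (lebesgue_power R n).-integrable (@cube R n) (EFin \o (fun t => W (tcons (x, t)))).
  apply/(integrable_mkcond _ mCn); apply: eq_integrable iWx => // y _.
  exact: Wx.
transitivity (\int[lebesgue_power R n]_(t in @cube R n) ((g x)%:E * (W (tcons (x, t)))%:E))%E.
  rewrite [RHS]integral_mkcond; apply: eq_integral => t _.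
  by rewrite /= !patchE tcube xI /=; case: ifP => // _; rewrite mulrC.
rewrite integralZl //.
have Ix : @unit_itv R x by exact/set_mem.
have Vx : (\int[lebesgue_power R n]_(t in @cube R n) (W (tcons (x, t)))%:E = 1)%E.
  have := V1 Ix; rewrite /Vop /Rintegral /=.
  rewrite (eq_integral (fun t => (W (tcons (x, t)))%:E)); last first.
    move=> t _; congr ((W _)%:E).
    by apply: eq_from_tnth => i; rewrite tnth_mktuple (tnth_nth 0).
  by rewrite -[X in _ -> _ = X]/(1%:E) => <-; rewrite fineK //; exact: integrable_fin_num.
by rewrite Vx mule1.
Qed.
End perm.

(** * The AM-GM bound on [G] by a one-dimensional integral *)

Lemma prod_le_mean_expn (R : realType) (v : nat) (y : 'I_v -> R) : (0 < v)%N ->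
  (forall a, 0 <= y a) -> \prod_(a < v) y a <= v%:R^-1 * \sum_(a < v) y a ^+ v.
Proof.
move=> v0 y0.
have S0 : 0 <= v%:R^-1 * \sum_(a < v) y a ^+ v.
  by rewrite mulr_ge0 ?invr_ge0 // sumr_ge0 // => a _; exact: exprn_ge0.
(* Raising both sides to the power [v] turns the left one into the product of the numbers
   [y a ^+ v], to which AM-GM applies. *)
rewrite -(@ler_pXn2r _ v) ?nnegrE ?prodr_ge0 // -prodrXl [X in X ^+ v]mulrC.
have := (@leif_AGM R 'I_v 'I_v (fun a => y a ^+ v) (fun a _ => exprn_ge0 v (y0 a))).1.
by rewrite /= card_ord.
Qed.

Section ae.
Context d (T : measurableType d) (R : realType) (mu : {measure set T -> \bar R}).

Lemma ae_le_Rintegral (D : set T) (f1 f2 : T -> R) : measurable D ->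
  mu.-integrable D (EFin \o f1) -> mu.-integrable D (EFin \o f2) ->
  {ae mu, forall x, D x -> f1 x <= f2 x} ->
  \int[mu]_(x in D) f1 x <= \int[mu]_(x in D) f2 x.
Proof.
move=> mD i1 i2 le12; rewrite -subr_ge0 -RintegralB//.
have mB : measurable_fun D (fun x => f2 x - f1 x).
  by apply: measurable_funB; apply/measurable_EFinP;
    [exact: (measurable_int mu i2)|exact: (measurable_int mu i1)].
(* The difference is replaced by its positive part, which equals it almost everywhere and is
   nonnegative everywhere. *)
rewrite /Rintegral (@ae_eq_integral _ _ _ mu D (fun x => (Num.max (f2 x - f1 x) 0)%:E)) //.
- by apply: fine_ge0; apply: integral_ge0 => x _; rewrite lee_fin le_max lexx orbT.
- exact/measurable_EFinP.
- by apply/measurable_EFinP; exact: measurable_maxr.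
- by apply: filterS le12 => x H Dx; rewrite max_l // subr_ge0 H.
Qed.

Lemma Rintegral_sum I (s : seq I) (D : set T) (f : I -> T -> R) : measurable D ->
  (forall i, mu.-integrable D (EFin \o f i)) ->
  \int[mu]_(x in D) (\sum_(i <- s) f i x) = \sum_(i <- s) \int[mu]_(x in D) f i x.
Proof.
move=> mD fi; elim: s => [|i s IH].
  by rewrite big_nil; under eq_Rintegral do rewrite big_nil; rewrite Rintegral_cst// mul0r.
rewrite big_cons -IH; under eq_Rintegral do rewrite big_cons; rewrite RintegralD//.
have := @integrable_sum _ _ _ mu D mD I s xpredT (fun i => EFin \o f i) (fun i _ => fi i).
apply: eq_integrable => // x _ /=.
by rewrite sumEFin.
Qed.
End ae.

Section reduction.
Context {R : realType}.
Local Notation mu := (@lebesgue_measure R).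
Local Notation realv n := (n.-tuple (measurableTypeR R)).
Local Notation I := (@unit_itv R).

Lemma measurable_unit_itv : measurable I.
Proof. exact: measurable_itv. Qed.

Lemma unit_itv_measure : mu I = 1%E.
Proof. by rewrite /unit_itv lebesgue_measure_itv /= lte_fin ltr01 oppr0 adde0. Qed.

Lemma integrable_unit_itv (g : R -> R) (M : R) : measurable_fun I g ->
  (forall x, I x -> `|g x| <= M) -> mu.-integrable I (EFin \o g).
Proof.
move=> mg gM; apply: measurable_bounded_integrable => //.
- exact: measurable_unit_itv.
- by rewrite [X in (X < _)%E]unit_itv_measure ltry.
- by exists M; split; [exact: num_real|move=> N MN x Ix; exact: le_trans (gM x Ix) (ltW MN)].
Qed.

Lemma integrable_cubeM v (W h : realv v -> R) :
  (lebesgue_power R v).-integrable (@cube R v) (EFin \o W) ->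
  measurable_fun (@cube R v) h -> (forall t, cube t -> 0 <= h t <= 1) ->
  (lebesgue_power R v).-integrable (@cube R v) (EFin \o (fun t => W t * h t)).
Proof.
move=> iW mh h01.
apply: (@integrableMl _ _ _ (lebesgue_power R v) _ (@measurable_cube R v) (EFin \o W) h) => //.
exists 1; split => // M M1 t Ct; case/andP: (h01 _ Ct) => h0 h1 /=.
by rewrite ger0_norm // (le_trans h1) // ltW.
Qed.

Lemma measurable_cube_tnth v (a : 'I_v) (g : R -> R) : measurable_fun I g ->
  measurable_fun (@cube R v) (fun t => g (tnth t a)).
Proof.
move=> mg; apply: (measurable_comp measurable_unit_itv) => //.
  by move=> _ [t Ct <-]; exact: Ct.
apply: measurable_funTS; exact: measurable_tnth.
Qed.

(** The transposition of [ord0] and [a] preserves the measure and, up to a null set, the kernel; so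
    every coordinate has the same marginal as the first. *)
Lemma integral_cube_coord v (W : realv v -> R) (g : R -> R) (a : 'I_v) :
  regular_kernel W -> measurable_fun I g -> (forall x, I x -> 0 <= g x <= 1) ->
  \int[lebesgue_power R v]_(t in @cube R v) (W t * g (tnth t a)) =
  \int[mu]_(x in I) g x.
Proof.
case: v W a => [W []//|n] W a [[iW sW] _ V1] mg g01.
have [ih intE] := integral_cube_first iW V1 mg g01.
rewrite /Rintegral -intE -(integral_permute (tperm ord0 a) ih).
have mC := @measurable_cube R n.+1.
congr fine; apply: ae_eq_integral => //.
- apply: measurable_int (integrable_cubeM iW (measurable_cube_tnth a mg) _).
  by move=> t Ct; exact: g01 (Ct a).
- exact: measurable_int (integrable_permute (tperm ord0 a) ih).
apply: filterS (sW (tperm ord0 a)) => t Wt Ct /=.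
by rewrite Wt // tnth_mktuple tpermL.
Qed.

Lemma color_fun_expn c (f : R -> 'rV[R]_c) (r : 'I_c) n : color_fun f ->
  measurable_fun I (fun x => f x 0 r ^+ n) /\
  forall x, I x -> 0 <= f x 0 r ^+ n <= 1.
Proof.
case=> mf f01 _; split; first exact: measurable_funX.
move=> x Ix; case/andP: (f01 x Ix r) => f0 f1.
by rewrite exprn_ge0 // exprn_ile1.
Qed.

Lemma G_le c v (W : realv v -> R) (f : R -> 'rV[R]_c) (r : 'I_c) : (0 < v)%N ->
  regular_kernel W -> color_fun f ->
  G W r f <= \int[mu]_(x in I) f x 0 r ^+ v.
Proof.
move=> v0 rW cf; have [[iW sW] Wpos V1] := rW.
have mC := @measurable_cube R v.
have [mf f01 _] := cf; have [mfv fv01] := color_fun_expn r v cf.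
pose h a (t : realv v) := W t * f (tnth t a) 0 r ^+ v.
have ih a : (lebesgue_power R v).-integrable (@cube R v) (EFin \o h a).
  apply: (integrable_cubeM iW (measurable_cube_tnth a mfv)).
  by move=> t Ct; exact: fv01 (Ct a).
have hE a : \int[lebesgue_power R v]_(t in @cube R v) h a t = \int[mu]_(x in I) f x 0 r ^+ v.
  exact: (@integral_cube_coord v W (fun x => f x 0 r ^+ v)).
have isum : (lebesgue_power R v).-integrable (@cube R v) (EFin \o (fun t => \sum_(a < v) h a t)).
  have := @integrable_sum _ _ _ (lebesgue_power R v) _ mC _ (index_enum 'I_v) xpredT
    (fun a => EFin \o h a) (fun a _ => ih a).
  by apply: eq_integrable => // t _; rewrite /= sumEFin.
have imean : (lebesgue_power R v).-integrable (@cube R v)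
   (EFin \o (fun t => v%:R^-1 * \sum_(a < v) h a t)).
  have := integrableZl mC v%:R^-1 isum.
  by apply: eq_integrable.
(* The target is rewritten as the mean of [v] equal integrals over the cube, so that the integrands
   can be compared pointwise. *)
have -> : \int[mu]_(x in I) f x 0 r ^+ v =
    \int[lebesgue_power R v]_(t in @cube R v) (v%:R^-1 * \sum_(a < v) h a t).
  rewrite RintegralZl // Rintegral_sum // (eq_bigr _ (fun a _ => hE a)).
  rewrite sumr_const card_ord mulrnAr -mulrnAl.
  by rewrite -[_ *+ v]mulr_natr mulVf ?mul1r // pnatr_eq0 -lt0n.
apply: ae_le_Rintegral => //.
  apply: (integrable_cubeM iW).
    by apply: measurable_prod => a _; exact: (measurable_cube_tnth a (mf r)).
  move=> t Ct; apply/andP; split.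
    by apply: prodr_ge0 => a _; case/andP: (f01 _ (Ct a) r).
  by apply: prodr_ile1 => a _; exact: f01 (Ct a) r.
(* The pointwise inequality is AM-GM multiplied by [W t], which is positive off a null set. *)
apply: filterS Wpos => t W0 Ct.
rewrite -mulr_sumr mulrCA; apply: ler_wpM2l; first exact/ltW/W0.
apply: prod_le_mean_expn => // a.
by case/andP: (f01 _ (Ct a) r).
Qed.

(** The kernel has total mass 1, by the marginal identity for the constant function 1. *)
Lemma G_cst c v (W : realv v -> R) (x : 'rV[R]_c) (r : 'I_c) : (0 < v)%N ->
  regular_kernel W -> G W r (cst x) = x 0 r ^+ v.
Proof.
case: v W => // n W _ rW; have [[iW _] _ _] := rW.
rewrite /G; under eq_Rintegral do rewrite prodr_const card_ord mulrC.
rewrite RintegralZl //; last exact: measurable_cube.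
have := @integral_cube_coord _ W (cst 1) ord0 rW (measurable_cst _).
under eq_Rintegral do rewrite /= mulr1.
move=> ->; last by move=> *; rewrite ler01 lexx.
rewrite Rintegral_cst; last exact: measurable_unit_itv.
by rewrite [X in fine X]unit_itv_measure mul1r mulr1.
Qed.

End reduction.

(** * Reduction to the simplex *)

(** The lower bound is [ln (1/x) < 1/x] multiplied by [x]. *)
Lemma mul_ln_bound (R : realType) (x : R) : 0 <= x <= 1 -> -1 <= x * ln x <= 0.
Proof.
case/andP; rewrite le_eqVlt => /predU1P[<- _|x0 x1]; first by rewrite mul0r; lra.
have lnx0 : ln x <= 0 by exact: ln_le0.
rewrite pmulr_rle0 // lnx0 andbT.
have := ln_sublinear (x := x^-1); rewrite invr_gt0 => /(_ x0).
rewrite lnV ?posrE // -(ltr_pM2l x0) mulfV ?gt_eqF // mulrN => ?; lra.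
Qed.

Definition color_energy (R : realType) (v : nat) (a h x : R) : R :=
  a * x ^+ v + h * x - x * ln x.

Definition free_energy (R : realType) (c v : nat) (alpha h x : 'rV[R]_c) : R :=
  \sum_(r < c) color_energy v (alpha 0 r) (h 0 r) (x 0 r).

Definition prob_simplex (R : realType) (c : nat) : set 'rV[R]_c :=
  [set x | (forall r, 0 <= x 0 r) /\ \sum_(r < c) x 0 r = 1].

Lemma prob_simplex_le1 (R : realType) c (x : 'rV[R]_c) r :
  prob_simplex x -> 0 <= x 0 r <= 1.
Proof.
case=> x0 <-; rewrite x0 (bigD1 r) //= lerDl; apply: sumr_ge0 => *; exact: x0.
Qed.

Section objective.
Context {R : realType} {c v : nat} (v0 : (0 < v)%N) (W : v.-tuple (measurableTypeR R) -> R).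
Hypothesis rW : regular_kernel W.
Local Notation mu := (@lebesgue_measure R).
Local Notation I := (@unit_itv R).
Implicit Types (alpha h x : 'rV[R]_c) (f : R -> 'rV[R]_c).

Lemma color_fun_simplex f u : color_fun f -> I u -> prob_simplex (f u).
Proof.
move=> [_ f01 f1] Iu; split=> [r|]; last exact: f1.
by case/andP: (f01 u Iu r).
Qed.

Lemma color_fun_cst x : prob_simplex x -> color_fun (cst x).
Proof.
by move=> Sx; split=> [r|u _ r|u _] /=; [|exact: prob_simplex_le1|case: Sx].
Qed.

Lemma integrable_color_term f r : color_fun f ->
  [/\ mu.-integrable I (EFin \o (fun u => f u 0 r ^+ v)),
      mu.-integrable I (EFin \o (fun u => f u 0 r)) &
      mu.-integrable I (EFin \o (fun u => f u 0 r * ln (f u 0 r)))].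
Proof.
move=> cf; have [mf f01 _] := cf; split.
- have [mfv fv] := color_fun_expn r v cf.
  apply: (integrable_unit_itv (M := 1)) => // u Iu.
  by case/andP: (fv u Iu) => ? ?; rewrite ger0_norm.
- apply: (integrable_unit_itv (M := 1)) => // u Iu.
  by case/andP: (f01 u Iu r) => ? ?; rewrite ger0_norm.
- apply: (integrable_unit_itv (M := 1)).
    apply: measurable_funM => //.
    exact: (measurableT_comp (@measurable_ln R) (mf r)).
  move=> u Iu; case/andP: (mul_ln_bound (f01 u Iu r)) => ? ?.
  by rewrite ler_norml; lra.
Qed.

Lemma integrable_color_energy f alpha h r : color_fun f ->
  mu.-integrable I (EFin \o (fun u => color_energy v (alpha 0 r) (h 0 r) (f u 0 r))).
Proof.
move=> cf; have [iv i1 il] := integrable_color_term r cf.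
have mI := @measurable_unit_itv R.
have := integrableB mI (integrableD mI (integrableZl mI (alpha 0 r) iv)
  (integrableZl mI (h 0 r) i1)) il.
exact: eq_integrable.
Qed.

Lemma integrable_free_energy f alpha h : color_fun f ->
  mu.-integrable I (EFin \o (fun u => free_energy v alpha h (f u))).
Proof.
move=> cf; have mI := @measurable_unit_itv R.
have := @integrable_sum _ _ _ mu I mI _ (index_enum 'I_c) xpredT _
  (fun r _ => integrable_color_energy alpha h r cf).
by apply: eq_integrable => // u _; rewrite /= sumEFin.
Qed.

Lemma integral_free_energy f alpha h : color_fun f ->
  \int[mu]_(u in I) free_energy v alpha h (f u) =
  \sum_(r < c) alpha 0 r * \int[mu]_(u in I) f u 0 r ^+ v
  + \sum_(r < c) h 0 r * \int[mu]_(u in I) f u 0 r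
  - \int[mu]_(u in I) (\sum_(r < c) f u 0 r * ln (f u 0 r)).
Proof.
move=> cf; have mI := @measurable_unit_itv R.
rewrite !Rintegral_sum //; last 2 first.
- by move=> r; case: (integrable_color_term r cf).
- by move=> r; exact: integrable_color_energy.
rewrite -big_split -sumrB; apply: eq_bigr => r _ /=.
have [iv i1 il] := integrable_color_term r cf.
have iZv := integrableZl mI (alpha 0 r) iv.
have iZ1 := integrableZl mI (h 0 r) i1.
rewrite RintegralB //; last exact: (integrableD mI iZv iZ1).
by rewrite RintegralD // !RintegralZl.
Qed.

Lemma objective_le f alpha h : (forall r, 0 <= alpha 0 r) -> color_fun f ->
  objective W alpha h f <= \int[mu]_(u in I) free_energy v alpha h (f u).
Proof.
move=> a0 cf; rewrite integral_free_energy // /objective !lerD2r.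
by apply: ler_sum => r _; apply: ler_wpM2l => //; exact: G_le.
Qed.

Lemma objective_cst x alpha h : prob_simplex x ->
  objective W alpha h (cst x) = free_energy v alpha h x.
Proof.
move=> /color_fun_cst cf.
transitivity (\int[mu]_(u in I) free_energy v alpha h (cst x u)).
  rewrite integral_free_energy // /objective; congr (_ + _ - _).
  apply: eq_bigr => r _; rewrite G_cst //= Rintegral_cst; last exact: measurable_unit_itv.
  by rewrite [X in fine X]unit_itv_measure mulr1.
rewrite /= Rintegral_cst; last exact: measurable_unit_itv.
by rewrite [X in fine X]unit_itv_measure mulr1.
Qed.

Lemma unique_maximizer_cst alpha h x : (forall r, 0 <= alpha 0 r) ->
  prob_simplex x ->
  (forall y, prob_simplex y -> free_energy v alpha h y <= free_energy v alpha h x) ->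
  (forall y, prob_simplex y -> free_energy v alpha h y = free_energy v alpha h x -> y = x) ->
  unique_maximizer W alpha h (cst x).
Proof.
move=> a0 Sx xmax xuniq.
set M := free_energy v alpha h x.
have mI := @measurable_unit_itv R.
have intM : \int[mu]_(u in I) M = M.
  by rewrite Rintegral_cst // [X in fine X]unit_itv_measure mulr1.
have iM : mu.-integrable I (EFin \o cst M).
  apply: (integrable_unit_itv (M := `|M|)) => //.
have le_int f : color_fun f ->
    \int[mu]_(u in I) free_energy v alpha h (f u) <= M.
  move=> cf; rewrite -intM; apply: le_Rintegral => //; first exact: integrable_free_energy.
  by move=> u Iu; exact/xmax/color_fun_simplex.
have supE : ereal_sup [set (objective W alpha h f)%:E | f in @color_fun R c] = M%:E.
  apply/eqP; rewrite eq_le; apply/andP; split.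
    apply: ge_ereal_sup => _ [f cf <-]; rewrite lee_fin.
    exact: le_trans (objective_le h a0 cf) (le_int f cf).
  apply: ereal_sup_ubound; exists (cst x); first exact: color_fun_cst.
  by rewrite objective_cst.
split.
  by split; [exact: color_fun_cst|rewrite /problem_value supE objective_cst // EFinB].
move=> g [cg]; rewrite /problem_value supE -EFinB => -[/addIr gM].
(* Optimality of [g] closes the chain [M = objective g <= \int Phi(g) <= M]. The nonnegative deficit
   [M - Phi(g)] thus has integral 0 and vanishes almost everywhere. *)
have intE : \int[mu]_(u in I) (M - free_energy v alpha h (g u)) = 0.
  have ig := integrable_free_energy alpha h cg.
  rewrite RintegralB // intM; apply/eqP; rewrite subr_eq0 eq_le le_int // andbT.
  by rewrite -{1}gM objective_le.
have ig := integrable_free_energy alpha h cg.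
have iD : mu.-integrable I (EFin \o (fun u => M - free_energy v alpha h (g u))).
  by have := integrableB mI iM ig; exact: eq_integrable.
have : (\int[mu]_(u in I) `|(M - free_energy v alpha h (g u))%:E| = 0)%E.
  transitivity (\int[mu]_(u in I) (M - free_energy v alpha h (g u))%:E)%E.
    apply: eq_integral => u /set_mem Iu; rewrite gee0_abs // lee_fin subr_ge0.
    exact/xmax/color_fun_simplex.
  rewrite -[LHS]fineK; last exact: integrable_fin_num.
  by congr (_%:E).
move/(ae_eq_integral_abs mu mI (measurable_int mu iD)).
apply: filterS => u gu Iu; apply: xuniq; first exact: color_fun_simplex.
by have /eqP := gu Iu; rewrite eqe subr_eq0 => /eqP.
Qed.

End objective.

(** * The energy on the simplex *)

Section xlnx.
Context {R : realType}.
Implicit Types x y : R.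

(** With [y = sqrt x], one has [x ln x = 2 y (y ln y)] and [|y ln y| <= 1]. For [x <= 0] the left
    side is 0, because [ln] vanishes there. *)
Lemma abs_mul_ln_le_sqrt x : x <= 1 -> `|x * ln x| <= 2 * Num.sqrt `|x|.
Proof.
move=> x1; have [x0|x0] := leP x 0.
  by rewrite ln0 // mulr0 normr0 mulr_ge0 // sqrtr_ge0.
rewrite (gtr0_norm x0); set y := Num.sqrt x.
have y0 : 0 < y by rewrite sqrtr_gt0.
have xE : x = y ^+ 2 by rewrite sqr_sqrtr // ltW.
have y1 : y <= 1 by rewrite -sqrtr1 ler_wsqrtr.
rewrite xE lnXn // [X in `|X|](_ : _ = 2 * y * (y * ln y)); last by ring.
rewrite normrM ger0_norm; last by rewrite mulr_ge0 // ltW.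
rewrite -[leRHS]mulr1; apply: ler_wpM2l; first by rewrite mulr_ge0 // ltW.
have := @mul_ln_bound R y; rewrite (ltW y0) y1 => /(_ isT) /andP[? ?].
by rewrite ler_norml; apply/andP; split; lra.
Qed.

Lemma continuous_mul_ln : continuous (fun x => x * ln x).
Proof.
move=> x; have [x0|x0|->] := ltgtP x 0.
- apply: (near_cst_continuous 0); near=> y.
  rewrite ln0 ?mulr0 // ltW //; near: y; exact: lt_nbhsl.
- by apply: continuousM; [exact: cvg_id|exact: continuous_ln].
rewrite /continuous_at mul0r; apply/cvgr0Pnorm_le => e e0.
pose f (y : R) := 2 * Num.sqrt `|y|.
have f0 : f 0 = 0 by rewrite /f normr0 sqrtr0 mulr0.
have : {for (0 : R), continuous f}.
  apply: continuousM; first exact: cst_continuous.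
  apply: continuous_comp; first exact: norm_continuous.
  exact: sqrt_continuous.
rewrite /prop_for /continuous_at f0.
move=> /cvgr0Pnorm_le /(_ _ e0) H; near=> y.
have y1 : y <= 1 by apply/ltW; near: y; apply: lt_nbhsl; exact: ltr01.
apply: le_trans (abs_mul_ln_le_sqrt y1) _.
have : `|2 * Num.sqrt `|y| | <= e by near: y.
by rewrite ger0_norm // mulr_ge0 // sqrtr_ge0.
Unshelve. all: by end_near. Qed.
End xlnx.

Section simplex.
Context {R : realType} {c v : nat}.
Implicit Types (alpha h x y : 'rV[R]_c).

Lemma continuous_sum_fun (T : topologicalType) n (F : 'I_n -> T -> R) :
  (forall i, continuous (F i)) -> continuous (fun t => \sum_(i < n) F i t).
Proof.
by move=> cF; apply: continuous_big => [t|i _]; [exact: add_continuous|exact: cF].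
Qed.

Lemma continuous_free_energy alpha h : continuous (@free_energy R c v alpha h).
Proof.
apply: continuous_sum_fun => r.
have cc : continuous (fun x : 'rV[R]_c => x 0 r) by exact: coord_continuous.
have c1 : continuous (fun x : R => alpha 0 r * x ^+ v + h 0 r * x - x * ln x).
  move=> t.
  apply: cvgB; last exact: continuous_mul_ln.
  apply: cvgD; apply: cvgM; [exact: cvg_cst|exact: exprn_continuous|exact: cvg_cst|exact: cvg_id].
by move=> x; apply: (@continuous_comp _ _ _ (fun x : 'rV[R]_c => x 0 r)); [exact: cc|exact: c1].
Qed.

(** The implied bounds [x_r <= 1] exhibit the simplex as a closed subset of a compact cube. *)
Lemma compact_prob_simplex : compact (@prob_simplex R c).
Proof.
rewrite (_ : @prob_simplex R c = [set x : 'rV[R]_c | forall i, `[0, 1]%classic (x ord0 i)]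
    `&` (fun x : 'rV[R]_c => \sum_(r < c) x 0 r) @^-1` [set 1]).
  apply: compact_closedI.
    by apply: (@rV_compact R c (fun=> `[0, 1]%classic)) => i; exact: segment_compact.
  apply: preimage_closed; last exact: closed_eq.
  by move=> x _; apply: continuous_sum_fun => r; exact: coord_continuous.
apply/seteqP; split=> x.
  by move=> Sx; split=> [i|]; [rewrite /= in_itv; exact: prob_simplex_le1|case: Sx].
by move=> [x01 x1]; split=> // r; have := x01 r; rewrite /= in_itv /= => /andP[].
Qed.

Lemma free_energy_argmax_exists alpha h (K : set 'rV[R]_c) : compact K -> K !=set0 ->
  exists2 x, K x & forall y, K y -> free_energy v alpha h y <= free_energy v alpha h x.
Proof.
move=> cK K0; have := @EVT_max_rV R c (free_energy v alpha h) K K0 cK.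
case; first exact/continuous_subspaceT/continuous_free_energy.
move=> x /set_mem Kx xmax; exists x => // y Ky; exact/xmax/mem_set.
Qed.

(** The l1 distance between parameter pairs, chosen because it bounds the change of the energy
    uniformly on the simplex. *)
Definition param_dist (p q : 'rV[R]_c * 'rV[R]_c) : R :=
  \sum_(r < c) (`|p.1 0 r - q.1 0 r| + `|p.2 0 r - q.2 0 r|).

Lemma continuous_param_dist p : continuous (param_dist ^~ p).
Proof.
apply: continuous_sum_fun => r q; apply: cvgD.
  apply: cvg_norm.
  apply: cvgB; last exact: cvg_cst.
  apply: (@continuous_comp _ _ _ fst (fun x : 'rV[R]_c => x 0 r)); first exact: cvg_fst.
  exact: coord_continuous.
apply: cvg_norm.
apply: cvgB; last exact: cvg_cst.
apply: (@continuous_comp _ _ _ snd (fun x : 'rV[R]_c => x 0 r)); first exact: cvg_snd.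
exact: coord_continuous.
Qed.

(** The energy is affine in the parameters, with coefficients [x_r ^+ v] and [x_r] in [0, 1]. *)
Lemma free_energy_param_le p q x : prob_simplex x ->
  free_energy v p.1 p.2 x <= free_energy v q.1 q.2 x + param_dist p q.
Proof.
move=> Sx; rewrite -big_split; apply: ler_sum => r _ /=; rewrite /color_energy.
have /andP[x0 x1] := prob_simplex_le1 r Sx.
have xv : 0 <= x 0 r ^+ v <= 1 by rewrite exprn_ge0 // exprn_ile1.
have key (d t : R) : 0 <= t <= 1 -> d * t <= `|d|.
  case/andP=> t0 t1; apply: le_trans (ler_norm _) _.
  by rewrite normrM (ger0_norm t0) ler_piMr.
have := key (p.1 0 r - q.1 0 r) _ xv.
have := key (p.2 0 r - q.2 0 r) (x 0 r).
rewrite x0 x1 !mulrBl => /(_ isT); lra.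
Qed.

Lemma param_dist_sym p q : param_dist p q = param_dist q p.
Proof. by apply: eq_bigr => r _; rewrite distrC [X in _ + X]distrC. Qed.

(** Off an open neighbourhood [V] of [x p] the simplex is compact, so by uniqueness the energy there
    stays below its maximum by a gap [2 gamma]. Parameters closer than [gamma] to [p] change each
    energy by less than [gamma], so their maximizer lies in [V]. *)
Lemma argmax_continuous (D : set ('rV[R]_c * 'rV[R]_c)) (x : 'rV[R]_c * 'rV[R]_c -> 'rV[R]_c) :
  (forall p, D p -> [/\ prob_simplex (x p),
    forall y, prob_simplex y -> free_energy v p.1 p.2 y <= free_energy v p.1 p.2 (x p) &
    forall y, prob_simplex y -> free_energy v p.1 p.2 y = free_energy v p.1 p.2 (x p) -> y = x p]) ->
  {within D, continuous x}.
Proof.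
move=> xD; apply/subspace_continuousP => p Dp U.
rewrite /= nbhsE => -[V [oV Vxp] VU].
have [Sp pmax puniq] := xD p Dp.
suff : nbhs p (fun q => D q -> U (x q)) by [].
set K := @prob_simplex R c `&` ~` V.
have cK : compact K by apply: compact_closedI; [exact: compact_prob_simplex|exact: open_closedC].
have [[k0 Kk0]|K0] := pselect (K !=set0); last first.
  apply: filterE => q Dq; apply: VU; apply: contrapT => nV.
  by apply: K0; exists (x q); split => //; case: (xD q Dq).
have [k [Sk Vk] kmax] := free_energy_argmax_exists p.1 p.2 cK (ex_intro _ k0 Kk0).
have gap : free_energy v p.1 p.2 k < free_energy v p.1 p.2 (x p).
  rewrite lt_neqAle pmax // andbT; apply/eqP => /(puniq k Sk) kx.
  by apply: Vk; rewrite kx.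
set gamma := (free_energy v p.1 p.2 (x p) - free_energy v p.1 p.2 k) / 2.
have gamma0 : 0 < gamma by rewrite divr_gt0 // subr_gt0.
have dp0 : param_dist p p = 0 by rewrite /param_dist big1 // => r _; rewrite !subrr normr0 addr0.
have : \forall q \near p, param_dist q p < gamma.
  have := @continuous_param_dist p p; rewrite /continuous_at dp0 => cvg0.
  by apply: (cvgr_lt 0 cvg0).
apply: filterS => q qp Dq; apply: VU; apply: contrapT => nV.
have [Sq qmax _] := xD q Dq.
have le1 := kmax (x q) (conj Sq nV).
have le2 := qmax (x p) Sp.
have le3 := free_energy_param_le q p Sq.
have le4 := free_energy_param_le p q Sp.
rewrite param_dist_sym in le4.
move: qp; rewrite /gamma; lra.
Qed.
End simplex.

(** * First-order conditions and uniqueness *)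

Section one_dim.
Context {R : realType}.
Implicit Types x y a h t m p : R.

Lemma expn_sub_bound n x y : 0 <= x -> x <= y -> y <= 1 ->
  0 <= y ^+ n - x ^+ n <= n%:R * (y - x).
Proof.
move=> x0 xy y1; have y0 := le_trans x0 xy.
rewrite subr_ge0 lerXn2r ?nnegrE //=; elim: n => [|n IH]; first by rewrite !expr0; lra.
have -> : y ^+ n.+1 - x ^+ n.+1 = y * (y ^+ n - x ^+ n) + x ^+ n * (y - x).
  by rewrite !exprS; ring.
have yn0 : 0 <= y ^+ n - x ^+ n by rewrite subr_ge0 lerXn2r ?nnegrE.
have H1 : y * (y ^+ n - x ^+ n) <= y ^+ n - x ^+ n by rewrite ler_piMl.
have xn1 : x ^+ n <= 1 by rewrite exprn_ile1 // (le_trans xy).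
have H2 : x ^+ n * (y - x) <= y - x by rewrite ler_piMl // subr_ge0.
rewrite -natr1 mulrDl mul1r; lra.
Qed.

Lemma ln_le_sub1 x : 0 < x -> ln x <= x - 1.
Proof. by move=> x0; have := @le_ln1Dx R (x - 1); rewrite [1 + _]addrC subrK; apply; lra. Qed.

Lemma ln_lt_sub1 x : 0 < x -> x != 1 -> ln x < x - 1.
Proof.
move=> x0 x1; rewrite -ltr_expR lnK ?posrE //.
have /expR_gt1Dx : x - 1 != 0 by rewrite subr_eq0.
by rewrite addrC subrK.
Qed.

Lemma ln_sub_ge x y : 0 < y -> 0 < x -> (x - y) / x <= ln x - ln y.
Proof.
move=> y0 x0; have : 0 < y / x by rewrite divr_gt0.
move/ln_le_sub1; rewrite ln_div ?posrE // mulrBl mulfV ?gt_eqF //; lra.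
Qed.

Lemma ln_sub_gt x y : 0 < y -> 0 < x -> x != y -> (x - y) / x < ln x - ln y.
Proof.
move=> y0 x0 xy; have yx0 : 0 < y / x by rewrite divr_gt0.
have : y / x != 1.
  by apply: contra_neq xy => /(congr1 ( *%R^~ x)); rewrite divfK ?gt_eqF // mul1r.
move/(ln_lt_sub1 yx0); rewrite ln_div ?posrE // mulrBl mulfV ?gt_eqF //; lra.
Qed.

Definition color_energy' v a h x : R := a * (v%:R * x ^+ v.-1) + h - ln x - 1.

Lemma is_derive_color_energy v a h x : 0 < x ->
  is_derive x 1 (color_energy v a h) (color_energy' v a h x).
Proof.
move=> x0.
have did := @is_derive_id R R x 1.
have dX : is_derive x 1 (fun y : R => y ^+ v) ((v%:R * x ^+ v.-1) *: (1 : R)).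
  by have := is_deriveX v did; rewrite exprfctE.
have D := is_deriveB (is_deriveD (is_deriveZ a dX) (is_deriveZ h did))
  (is_deriveM did (is_derive1_ln x0)).
apply: (@is_derive_eq _ _ _ (color_energy v a h) x 1 _ _ D).
rewrite /color_energy' /GRing.scale /= !mulr1 mulfV ?gt_eqF //; ring.
Qed.

(** Moving a small mass [t] to an empty colour gains [- t ln t] in entropy, which beats all losses,
    as these are linear in [t]. *)
Lemma pair_max_pos v a h a' h' m : 0 <= a -> 0 <= a' -> 0 < m -> m <= 1 ->
  exists2 t, 0 < t < m &
  color_energy v a h 0 + color_energy v a' h' m <
  color_energy v a h t + color_energy v a' h' (m - t).
Proof.
move=> a0 a'0 m0 m1.
(* [K] collects the linear coefficients: the gain is at least [t (K - ln t)], hence at least [t]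
   once [ln t <= K - 1]. *)
set K := h - h' - a' * v%:R + ln m.
pose t := Num.min (m / 2) (expR (K - 1)).
have t0 : 0 < t by rewrite lt_min divr_gt0 // expR_gt0.
have tm : t <= m / 2 by rewrite ge_min lexx.
have lnt : ln t <= K - 1 by rewrite -[leRHS]expRK ler_ln ?posrE ?expR_gt0 // ge_min lexx orbT.
exists t; first by apply/andP; split; lra.
have H1 := @expn_sub_bound v (m - t) m.
have {}H1 : a' * m ^+ v - a' * (m - t) ^+ v <= a' * v%:R * t.
  rewrite -mulrBr -mulrA ler_wpM2l //; have /andP[_ H] := H1 ltac:(lra) ltac:(lra) m1.
  by apply: le_trans H _; rewrite ler_wpM2l //; lra.
have H2 : (m - t) * ln (m - t) <= (m - t) * ln m.
  by rewrite ler_wpM2l ?ler_ln ?posrE; lra.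
have H3 : a * 0 ^+ v <= a * t ^+ v.
  by rewrite ler_wpM2l //; apply: lerXn2r; rewrite ?nnegrE //; exact: ltW.
have H4 : t * ln t <= t * (K - 1) by rewrite ler_wpM2l // ltW.
rewrite /color_energy; move: H1 H2 H3 H4; rewrite /K.
move: (0 ^+ v) (t ^+ v) (m ^+ v) ((m - t) ^+ v) (ln _) (ln _) (ln _) (ln _).
move=> *; lra.
Qed.

Lemma pair_max_stationary v a h a' h' m p : 0 < p < m ->
  (forall t, 0 <= t <= m -> color_energy v a h t + color_energy v a' h' (m - t) <=
     color_energy v a h p + color_energy v a' h' (m - p)) ->
  color_energy' v a h p = color_energy' v a' h' (m - p).
Proof.
move=> pm pmax.
pose f t := color_energy v a h t + color_energy v a' h' (m - t).
have df t : 0 < t < m -> is_derive t 1 f (color_energy' v a h t - color_energy' v a' h' (m - t)).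
  move=> /andP[t0 tm].
  have mt0 : 0 < m - t by rewrite subr_gt0.
  have dm : is_derive t 1 (fun s => m - s) (- 1).
    have D := is_deriveB (@is_derive_cst R R R m t 1) (@is_derive_id R R t 1).
    by apply: (@is_derive_eq _ _ _ (fun s => m - s) t 1 _ _ D); rewrite sub0r.
  have D := is_deriveD (is_derive_color_energy v a h t0)
    (@is_derive1_comp R (color_energy v a' h') (fun s => m - s) t _ _
      (is_derive_color_energy v a' h' mt0) dm).
  by apply: (@is_derive_eq _ _ _ f t 1 _ _ D); rewrite mulrN1.
have [|t|||_ D0] := @derive1_at_max R f 0 m p.
- lra.
- by rewrite in_itv /= => /df [].
- by rewrite in_itv.
- by move=> t; rewrite in_itv /= => /andP[? ?]; apply: pmax; rewrite !ltW.
have [_ D1] := df p pm.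
by move: D1; rewrite D0 => /esym/eqP; rewrite subr_eq0 => /eqP.
Qed.

(** With [p = u^(v-1)] and [q = t^(v-1)], both at most 1,
    [p - q < ln p - ln q = (v-1)(ln u - ln t)]. The bound on [a] is what makes [a v (p - q)] at most
    [(p - q)/(v-1)]. *)
Lemma color_energy'_lt v a h (t u : R) : (1 < v)%N -> 0 <= a <= (v%:R * (v%:R - 1))^-1 ->
  0 < t -> t < u -> u <= 1 -> color_energy' v a h u < color_energy' v a h t.
Proof.
move=> v1 /andP[a0 aV] t0 tu u1.
have u0 : 0 < u by exact: lt_trans tu.
set n : R := v%:R - 1.
have n0 : 0 < n by rewrite subr_gt0 ltr1n.
have v0 : 0 < v%:R :> R by rewrite ltr0n ltnW.
have nE : v.-1%:R = n by rewrite /n -subn1 natrB // ltnW.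
have v1p : (0 < v.-1)%N by rewrite -subn1 subn_gt0.
set p := u ^+ v.-1; set q := t ^+ v.-1.
have p0 : 0 < p by exact: exprn_gt0.
have q0 : 0 < q by exact: exprn_gt0.
have qp : q < p by rewrite ltrXn2r -?lt0n ?nnegrE ?ltW.
have p1 : p <= 1 by rewrite exprn_ile1 // ltW.
have lnpq : ln p - ln q = n * (ln u - ln t).
  by rewrite /p /q !lnXn // -[ln u *+ _]mulr_natl -[ln t *+ _]mulr_natl nE mulrBr.
have H1 : p - q < n * (ln u - ln t).
  rewrite -lnpq; apply: le_lt_trans (ln_sub_gt q0 p0 _); last by rewrite gt_eqF.
  by rewrite ler_pdivlMr // ler_piMr // subr_ge0 ltW.
have H2 : n * (a * (v%:R * (p - q))) <= p - q.
  have -> : n * (a * (v%:R * (p - q))) = a * (v%:R * n) * (p - q) by ring.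
  rewrite ler_piMl ?subr_ge0 ?(ltW qp) //.
  by rewrite -ler_pdivlMr ?mulr_gt0 // div1r.
have H3 : a * (v%:R * (p - q)) < ln u - ln t.
  by rewrite -(ltr_pM2l n0); exact: le_lt_trans H1.
rewrite /color_energy' -/p -/q; move: H3; rewrite !mulrBr; lra.
Qed.

(** Below [delta] the logarithm has slope at least [1/delta], while the interaction term has slope
    at most [L]. With [delta = 1] this bounds the growth rate of the derivative by [L - 1]. *)
Lemma color_energy'_gap v a h (L delta t u : R) : (0 < v)%N -> 0 <= a ->
  a * (v%:R * (v%:R - 1)) <= L -> 0 < u -> u <= t -> t <= 1 -> t <= delta ->
  (delta^-1 - L) * (t - u) <= color_energy' v a h u - color_energy' v a h t.
Proof.
move=> v0 a0 aL u0 ut t1 td.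
have t0 : 0 < t by exact: lt_le_trans ut.
have H1 := ln_sub_ge u0 t0.
have H2 : (t - u) / delta <= (t - u) / t.
  by rewrite ler_wpM2l ?subr_ge0 // lef_pV2 ?posrE // (lt_le_trans t0).
have /andP[_] := expn_sub_bound v.-1 (ltW u0) ut t1.
rewrite -subn1 natrB // => H3.
have H4 : a * (v%:R * (t ^+ v.-1 - u ^+ v.-1)) <= L * (t - u).
  apply: (@le_trans _ _ (a * (v%:R * ((v%:R - 1) * (t - u))))).
    by rewrite -subn1 !ler_wpM2l.
  by rewrite [v%:R * _]mulrA mulrA ler_wpM2r // subr_ge0.
rewrite /color_energy'; move: H1 H2 H4; rewrite [_ / delta]mulrC !mulrBl !mulrBr.
move: (t ^+ v.-1) (u ^+ v.-1) (ln t) (ln u) => *; lra.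
Qed.

End one_dim.

Section first_order.
Context {R : realType} {c : nat} (v : nat).
Implicit Types (alpha h x y : 'rV[R]_c).

Definition free_energy_argmax alpha h x :=
  prob_simplex x /\
  forall y, prob_simplex y -> free_energy v alpha h y <= free_energy v alpha h x.

(** Redistributing the joint mass of two colours stays on the simplex, which reduces first-order
    conditions to one variable. *)
Lemma argmax_pair alpha h x (r q : 'I_c) t : r != q -> free_energy_argmax alpha h x ->
  0 <= t <= x 0 r + x 0 q ->
  color_energy v (alpha 0 r) (h 0 r) t +
    color_energy v (alpha 0 q) (h 0 q) (x 0 r + x 0 q - t) <=
  color_energy v (alpha 0 r) (h 0 r) (x 0 r) + color_energy v (alpha 0 q) (h 0 q) (x 0 q).
Proof.
move=> rq [[x0 x1] xmax] /andP[t0 tm].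
pose y : 'rV[R]_c := \row_i (if i == r then t else if i == q then x 0 r + x 0 q - t else x 0 i).
have yr : y 0 r = t by rewrite mxE eqxx.
have yq : y 0 q = x 0 r + x 0 q - t by rewrite mxE eq_sym (negbTE rq) eqxx.
have split2 (F : 'I_c -> R) : \sum_(i < c) F i = F r + (F q + \sum_(i < c | (i != r) && (i != q)) F i).
  by rewrite (bigD1 r) //= (bigD1 q) //= eq_sym.
have yi i : (i != r) && (i != q) -> y 0 i = x 0 i.
  by case/andP=> ir iq; rewrite mxE (negbTE ir) (negbTE iq).
have Sy : prob_simplex y.
  split=> [i|].
    by rewrite mxE; case: ifP => // _; case: ifP => // _; rewrite subr_ge0.
  rewrite split2 yr yq -[RHS]x1 split2 (eq_bigr _ yi); ring.
have := xmax y Sy; rewrite /free_energy !split2 yr yq.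
rewrite [X in _ + (_ + X) <= _](eq_bigr (fun i => color_energy v (alpha 0 i) (h 0 i) (x 0 i))); last first.
  by move=> i /yi ->.
lra.
Qed.

Lemma argmax_positive alpha h x : (forall r, 0 <= alpha 0 r) ->
  free_energy_argmax alpha h x -> forall r, 0 < x 0 r.
Proof.
move=> a0 xmax r; have [[x0 x1] _] := xmax.
rewrite lt_def x0 andbT; apply/eqP => xr0.
have [q xq0] : exists q, 0 < x 0 q.
  apply/not_existsP => nq; have : \sum_(i < c) x 0 i <= 0.
    by apply: sumr_le0 => i _; rewrite leNgt; apply/negP => /nq.
  by rewrite x1 ler10.
have rq : r != q by apply: contraTneq xq0 => <-; rewrite xr0 ltxx.
have xq1 : x 0 q <= 1 by case/andP: (prob_simplex_le1 q (proj1 xmax)).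
have [t /andP[t0 tm]] := pair_max_pos v (h 0 r) (h 0 q) (a0 r) (a0 q) xq0 xq1.
have := argmax_pair (t := t) rq xmax; rewrite xr0 add0r (ltW t0) (ltW tm) => /(_ isT).
by rewrite leNgt => /negP.
Qed.

Lemma argmax_stationary alpha h x r q : (forall r, 0 <= alpha 0 r) ->
  free_energy_argmax alpha h x ->
  color_energy' v (alpha 0 r) (h 0 r) (x 0 r) = color_energy' v (alpha 0 q) (h 0 q) (x 0 q).
Proof.
move=> a0 xmax; have [->//|rq] := eqVneq r q.
have xp := argmax_positive a0 xmax.
have E : x 0 r + x 0 q - x 0 r = x 0 q by ring.
rewrite -[in RHS]E; apply: pair_max_stationary.
  by have := xp r; have := xp q; move=> ? ?; apply/andP; split; lra.
by move=> t tm; rewrite E; exact: argmax_pair.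
Qed.


Lemma subcritical_argmax_unique alpha h x y : (1 < v)%N ->
  (forall r, 0 <= alpha 0 r <= (v%:R * (v%:R - 1))^-1) ->
  free_energy_argmax alpha h x -> free_energy_argmax alpha h y -> x = y.
Proof.
move=> v1 aV.
have a0 r : 0 <= alpha 0 r by case/andP: (aV r).
pose lam x' r := color_energy' v (alpha 0 r) (h 0 r) (x' 0 r).
suff main x' y' : free_energy_argmax alpha h x' -> free_energy_argmax alpha h y' ->
    (forall r, lam x' r <= lam y' r) -> x' = y'.
  (* By stationarity [lam] does not depend on the colour, so a single comparison orders the
     multipliers, and [x] and [y] may be swapped. *)
  move=> mx my; have [xy|/existsNP[q /negP]] := pselect (forall r, lam x r <= lam y r).
    exact: main.
  rewrite -ltNge => yx; apply/esym/main => // r.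
  by rewrite /lam (argmax_stationary r q a0 mx) (argmax_stationary r q a0 my) ltW.
move=> mx my xy.
have yx r : y' 0 r <= x' 0 r.
  rewrite leNgt; apply/negP => xyr; have := xy r; apply/negP; rewrite -ltNge.
  apply: color_energy'_lt => //; first exact: (argmax_positive a0 mx).
  by case/andP: (prob_simplex_le1 r (proj1 my)).
have S0 : \sum_(r < c) (x' 0 r - y' 0 r) = 0.
  by rewrite sumrB (proj2 (proj1 mx)) (proj2 (proj1 my)) subrr.
apply/rowP => r; apply/eqP; rewrite -subr_eq0; apply/eqP.
apply: (psumr_eq0P (P := xpredT) (F := fun r => x' 0 r - y' 0 r)) => // i _.
by rewrite subr_ge0.
Qed.

(** If the multiplier of [x] is at most that of [y], then [y_r <= x_r] for [r <> k],
    and the excess [D = sum_(r <> k) (x_r - y_r) = y_k - x_k] satisfies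
    [(1/delta - L) D <= (c - 1) (L - 1) D], which forces [D = 0]. *)
Lemma small_argmax_unique alpha h (k : 'I_c) (L delta : R) x y : (0 < v)%N ->
  (forall r, 0 <= alpha 0 r) -> (forall r, alpha 0 r * (v%:R * (v%:R - 1)) <= L) ->
  0 <= L -> 0 < delta -> c%:R * L * delta < 1 ->
  free_energy_argmax alpha h x -> free_energy_argmax alpha h y ->
  (forall r, r != k -> x 0 r <= delta /\ y 0 r <= delta) -> x = y.
Proof.
move=> v0 a0 aL L0 d0 cLd.
pose lam x' r := color_energy' v (alpha 0 r) (h 0 r) (x' 0 r).
suff main x' y' : free_energy_argmax alpha h x' -> free_energy_argmax alpha h y' ->
    (forall r, r != k -> x' 0 r <= delta /\ y' 0 r <= delta) ->
    lam x' k <= lam y' k -> x' = y'.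
  move=> mx my xyd; have [xy|yx] := leP (lam x k) (lam y k); first exact: main.
  apply/esym/main => //; last exact: ltW.
  by move=> r /xyd[].
move=> mx my xyd; set e := lam y' k - lam x' k => xyk.
have e0 : 0 <= e by rewrite subr_ge0.
have eE r : lam y' r - lam x' r = e.
  by rewrite /e /lam (argmax_stationary r k a0 mx) (argmax_stationary r k a0 my).
have xp := argmax_positive a0 mx; have yp := argmax_positive a0 my.
have x1 r : x' 0 r <= 1 by case/andP: (prob_simplex_le1 r (proj1 mx)).
have y1 r : y' 0 r <= 1 by case/andP: (prob_simplex_le1 r (proj1 my)).
have Ld : c%:R * L < delta^-1 by rewrite -[ltRHS]div1r ltr_pdivlMr.
have c1 : 1 <= c%:R :> R by rewrite ler1n (leq_ltn_trans _ (ltn_ord k)).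
have gap0 : 0 < delta^-1 - L.
  by rewrite subr_gt0; apply: le_lt_trans Ld; rewrite ler_peMl.
have yx r : r != k -> y' 0 r <= x' 0 r.
  move=> rk; rewrite leNgt; apply/negP => xyr.
  have := color_energy'_gap (h 0 r) v0 (a0 r) (aL r) (xp r) (ltW xyr) (y1 r) (proj2 (xyd r rk)).
  rewrite -/(lam x' r) -/(lam y' r) leNgt => /negP; apply.
  apply: le_lt_trans (_ : 0 < _); first by have := eE r; lra.
  by rewrite mulr_gt0 // subr_gt0.
have gapr r : r != k -> (delta^-1 - L) * (x' 0 r - y' 0 r) <= e.
  move=> rk; rewrite -(eE r); apply: color_energy'_gap => //; first exact: yx.
  by case: (xyd r rk).
set D := \sum_(r < c | r != k) (x' 0 r - y' 0 r).
have D0 : 0 <= D by apply: sumr_ge0 => r /yx; rewrite subr_ge0.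
have DE : y' 0 k - x' 0 k = D.
  have := proj2 (proj1 mx); have := proj2 (proj1 my).
  rewrite /D sumrB (bigD1 k) //= => H1; rewrite (bigD1 k) //= => H2; lra.
have DL : (delta^-1 - L) * D <= (c%:R - 1) * e.
  rewrite /D mulr_sumr; apply: le_trans (ler_sum _ gapr) _.
  rewrite sumr_const (_ : #|_| = c.-1); last by rewrite cardC1 card_ord.
  by rewrite -subn1 -[leLHS]mulr_natl natrB // (leq_ltn_trans _ (ltn_ord k)).
(* For the colour [k], where only the bound 1 is at hand, the gap estimate is used with
   [delta = 1]. *)
have eL : e <= (L - 1) * D.
  have yxk : x' 0 k <= y' 0 k by rewrite -subr_ge0 DE.
  have := color_energy'_gap (h 0 k) v0 (a0 k) (aL k) (xp k) yxk (y1 k) (y1 k).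
  rewrite -/(lam x' k) -/(lam y' k) invr1 DE /e; lra.
(* [DL] and [eL] give [D / delta <= c L D - (c - 1) D <= c L D], which contradicts [c L delta < 1]
   if [D > 0]. *)
have D00 : D = 0.
  apply/eqP; rewrite eq_le D0 andbT leNgt; apply/negP => Dp.
  have : (c%:R - 1) * e <= (c%:R - 1) * ((L - 1) * D) by rewrite ler_wpM2l // subr_ge0.
  have : (c%:R - 1) * D >= 0 by rewrite mulr_ge0 // subr_ge0.
  have : c%:R * L * D < delta^-1 * D by rewrite ltr_pM2r.
  move: DL; rewrite !mulrBl !mulrBr; lra.
have xyr r : r != k -> x' 0 r = y' 0 r.
  move=> rk; apply/eqP; rewrite -subr_eq0; apply/eqP.
  apply: (psumr_eq0P (P := fun r => r != k) (F := fun r => x' 0 r - y' 0 r)) => // i /yx.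
  by rewrite subr_ge0.
apply/rowP => r; have [->|/xyr//] := eqVneq r k.
by apply/esym/eqP; rewrite -subr_eq0 DE D00.
Qed.

End first_order.

(** * Dominating colours *)

Section dominant.
Context {R : realType} {c : nat} (v : nat).
Implicit Types (alpha h x y : 'rV[R]_c).

Lemma prob_simplex_compl x (k r : 'I_c) : prob_simplex x -> r != k ->
  x 0 r <= 1 - x 0 k.
Proof.
move=> [x0 <-] rk; rewrite (bigD1 k) //= addrAC subrr add0r (bigD1 r) //= lerDl.
exact: sumr_ge0.
Qed.

(** Compare with the vertex [e_k]; the entropy is bounded crudely by [c]. *)
Lemma argmax_mass alpha h (k : 'I_c) (g : R) x : (0 < v)%N -> (forall r, 0 <= alpha 0 r) ->
  (forall r, r != k -> alpha 0 r + h 0 r <= alpha 0 k + h 0 k - g) ->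
  free_energy_argmax v alpha h x -> g * (1 - x 0 k) <= c%:R.
Proof.
move=> v0 a0 ahg [Sx xmax]; have [x0 x1] := Sx.
have Sk : prob_simplex (delta_mx 0 k : 'rV[R]_c).
  split=> [r|]; first by rewrite mxE eqxx /= ler0n.
  by rewrite (bigD1 k) //= big1 => [|r /negbTE rk]; rewrite mxE eqxx ?rk ?eqxx ?addr0.
have := xmax _ Sk; rewrite /free_energy (bigD1 k) //= mxE !eqxx /= big1; last first.
  by move=> r /negbTE rk; rewrite mxE rk andbF /color_energy expr0n gtn_eqF // !mulr0 mul0r subr0 addr0.
rewrite {1}/color_energy expr1n ln1 !mulr1 mul1r subr0 addr0 => le1.
(* On [0, 1], [x^v <= x] linearizes the interaction, and the entropy of each colour is at most 1. *)
have le2 : free_energy v alpha h x <= \sum_(r < c) ((alpha 0 r + h 0 r) * x 0 r + 1).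
  apply: ler_sum => r _; rewrite /color_energy.
  have xr := prob_simplex_le1 r Sx; have /andP[xr0 xr1] := xr.
  have /andP[e1 _] := mul_ln_bound xr.
  have : alpha 0 r * x 0 r ^+ v <= alpha 0 r * x 0 r.
    by rewrite ler_wpM2l // -[leRHS]expr1 ler_wiXn2l.
  rewrite mulrDl; lra.
have mass : \sum_(r < c | r != k) x 0 r = 1 - x 0 k.
  by have := x1; rewrite (bigD1 k) //= => <-; ring.
have le3 : \sum_(r < c) ((alpha 0 r + h 0 r) * x 0 r + 1) <=
    (alpha 0 k + h 0 k) - g * (1 - x 0 k) + c%:R.
  rewrite big_split /= sumr_const card_ord lerD2r (bigD1 k) //=.
  apply: (@le_trans _ _ ((alpha 0 k + h 0 k) * x 0 k +
      \sum_(r < c | r != k) (alpha 0 k + h 0 k - g) * x 0 r)).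
    by rewrite lerD2l; apply: ler_sum => r rk; rewrite ler_wpM2r // ahg.
  by rewrite -mulr_sumr mass !mulrBl !mulrBr; lra.
have := le_trans le1 (le_trans le2 le3); lra.
Qed.

(** Stationarity solved for [ln x_r] reads [ln x_k + h_r - h_k + v (alpha_r q - alpha_k pk)], with
    [q = x_r^(v-1)] and [pk = x_k^(v-1)]. Since [x_k] is close to 1, [pk - q >= 1/2], whence the
    factor [exp(- v alpha_k / 2)]. *)
Lemma argmax_small alpha h (k r : 'I_c) (a b : R) x : (1 < v)%N ->
  (forall r, 0 <= alpha 0 r) -> 0 <= a -> alpha 0 r <= alpha 0 k + a ->
  h 0 r <= h 0 k + b -> r != k -> 1 - x 0 k <= (2 * v%:R)^-1 ->
  free_energy_argmax v alpha h x ->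
  x 0 r <= expR (b + v%:R * a - v%:R * alpha 0 k / 2).
Proof.
move=> v0 a0 a_0 ark hrk rk xk xmax; have [Sx _] := xmax; have [x0 x1] := Sx.
have xp := argmax_positive a0 xmax.
have /andP[_ xk1] := prob_simplex_le1 k Sx.
have vp : 0 < v%:R :> R by rewrite ltr0n ltnW.
have xr : x 0 r <= 1 - x 0 k.
  exact: prob_simplex_compl.
rewrite -[leLHS]lnK ?posrE // ler_expR.
have := argmax_stationary r k a0 xmax; rewrite /color_energy'.
have /andP[_] := expn_sub_bound v.-1 (ltW (xp k)) xk1 (lexx 1).
have vE : v.-1%:R = v%:R - 1 :> R by rewrite -subn1 natrB // ltnW.
rewrite expr1n vE; set pk := x 0 k ^+ v.-1 => Hk.
set q := x 0 r ^+ v.-1.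
have q0 : 0 <= q by rewrite exprn_ge0.
have xr1 : x 0 r <= 1 by case/andP: (prob_simplex_le1 r Sx).
have qx : q <= x 0 r by rewrite /q -[leRHS]expr1 ler_wiXn2l // -subn1 subn_gt0.
have q1 : q <= 1 by exact: le_trans xr1.
have lnk : ln (x 0 k) <= 0 by rewrite ln_le0.
have vxk : v%:R * (1 - x 0 k) <= 2^-1.
  by rewrite mulrC -ler_pdivlMr // -invfM.
have H1 : alpha 0 r * (v%:R * q) <= (alpha 0 k + a) * (v%:R * q).
  by rewrite ler_wpM2r // mulr_ge0 // ltW.
have H2 : a * v%:R * q <= a * v%:R by rewrite ler_piMr // mulr_ge0 // ltW.
(* Here [pk >= 1 - (v-1)(1 - x_k)] and [q <= x_r <= 1 - x_k], so
   [pk - q >= 1 - v (1 - x_k) >= 1/2]. *)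
have H3 : (alpha 0 k * v%:R) * (q - pk) <= (alpha 0 k * v%:R) * (- 2^-1).
  apply: ler_wpM2l; first by rewrite mulr_ge0 // ltW.
  move: Hk vxk qx xr; rewrite !mulrBl !mulrBr; lra.
move: H1 H2 H3; rewrite !mulrDl !mulrBr; lra.
Qed.

(** [a] and [b] bound the excess of the other colours over [k] in [alpha] and [h].
    The exponential is the bound of [argmax_small] on their coordinates, and the last
    condition is the smallness required by [small_argmax_unique]. *)
Definition dominant alpha h (k : 'I_c) (a b : R) : Prop :=
  [/\ 0 <= a, forall r, 0 <= alpha 0 r,
    forall r, r != k -> [/\ alpha 0 r <= alpha 0 k + a, h 0 r <= h 0 k + b &
       alpha 0 r + h 0 r <= alpha 0 k + h 0 k - 2 * v%:R * c%:R] &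
    (alpha 0 k + a) * (v%:R * (v%:R - 1)) * c%:R *
      expR (b + v%:R * a - v%:R * alpha 0 k / 2) < 1].

Lemma dominant_argmax alpha h k a b : (1 < v)%N -> dominant alpha h k a b ->
  (forall x y, free_energy_argmax v alpha h x -> free_energy_argmax v alpha h y -> x = y) /\
  forall x, free_energy_argmax v alpha h x -> forall r, r != k -> x 0 r < x 0 k.
Proof.
move=> v1 [a_0 a0 dom small].
have v0 : (0 < v)%N := ltnW v1.
have vp : 2 <= v%:R :> R by rewrite ler_nat.
have cp : 0 < c%:R :> R by rewrite ltr0n (leq_ltn_trans _ (ltn_ord k)).
(* The gap [2 v c] in [dominant] is chosen so that [argmax_mass] yields the closeness to 1 assumed
   by [argmax_small]. *)
have mass x : free_energy_argmax v alpha h x -> 1 - x 0 k <= (2 * v%:R)^-1.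
  move=> mx; have := argmax_mass v0 a0 (fun r rk => let: And3 _ _ H := dom r rk in H) mx.
  by rewrite mulrAC ger_pMl // -ler_pdivlMl ?mulr1 // mulr_gt0 //; lra.
split=> [x y mx my|x mx r rk].
  apply: (@small_argmax_unique R c v alpha h k ((alpha 0 k + a) * (v%:R * (v%:R - 1)))
    (expR (b + v%:R * a - v%:R * alpha 0 k / 2))) => //.
  - move=> r; apply: ler_wpM2r; first by rewrite mulr_ge0 //; lra.
    by have [->|/dom[]//] := eqVneq r k; rewrite lerDl.
  - by apply: mulr_ge0; [rewrite addr_ge0|rewrite mulr_ge0; lra].
  - exact: expR_gt0.
  - by rewrite [c%:R * _]mulrC.
  move=> r rk; have [H1 H2 _] := dom r rk.
  by split; apply: (argmax_small (h := h)) => //; exact: mass.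
have [Sx _] := mx.
have : x 0 r <= 1 - x 0 k.
  exact: prob_simplex_compl.
(* As [v >= 2], this gives [x_r <= 1 - x_k <= 1/4 < 3/4 <= x_k]. *)
have := mass x mx; have : (2 * v%:R)^-1 <= 4^-1 :> R by rewrite lef_pV2 ?posrE; lra.
lra.
Qed.

End dominant.

(** * Explicit thresholds and conclusion *)

Section main.
Context {R : realType} {c v : nat} (hc : (2 <= c)%N) (hv : (2 <= v)%N).
Implicit Types (alpha h x y : 'rV[R]_c).
Local Notation k := (color1 hc).

Lemma max_all_ge x r : x 0 r <= max_all hc x.
Proof. exact: le_bigmax. Qed.

Lemma max_rest_ge x r : r != k -> x 0 r <= max_rest hc x.
Proof. by move=> rk; apply: le_bigmax_cond. Qed.

Lemma max_rest_lt x (t : R) : (forall r, r != k -> x 0 r < t) -> max_rest hc x < t.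
Proof. by move=> xt; apply: bigmax_lt => //; exact: xt. Qed.

Lemma prob_simplex_nonempty : (@prob_simplex R c) !=set0.
Proof.
exists (delta_mx 0 k); split=> [r|]; first by rewrite mxE eqxx /= ler0n.
by rewrite (bigD1 k) //= big1 => [|r /negbTE rk]; rewrite mxE eqxx ?rk ?eqxx ?addr0.
Qed.

Lemma argmax_exists alpha h : exists x, free_energy_argmax v alpha h x.
Proof.
have [x Sx xmax] := @free_energy_argmax_exists R c v alpha h _
  (@compact_prob_simplex R c) prob_simplex_nonempty.
by exists x.
Qed.

Lemma unique_argmax_maximizer (W : v.-tuple (measurableTypeR R) -> R) alpha h x :
  regular_kernel W -> (forall r, 0 <= alpha 0 r) -> free_energy_argmax v alpha h x ->
  (forall y, free_energy_argmax v alpha h y -> y = x) ->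
  unique_maximizer W alpha h (cst x).
Proof.
move=> rW a0 [Sx xmax] xuniq; apply: unique_maximizer_cst => //; first exact: ltnW.
by move=> y Sy yx; apply: xuniq; split=> // z Sz; rewrite yx; exact: xmax.
Qed.

Lemma dominant_maximizer (W : v.-tuple (measurableTypeR R) -> R) (D : set ('rV[R]_c * 'rV[R]_c)) :
  regular_kernel W ->
  (forall p, D p -> exists a b, dominant v p.1 p.2 k a b) ->
  dominant_continuous_maximizer hc W D.
Proof.
move=> rW dom.
(* Argmaxes exist for all pairs, so [choice] gives a total function; on [D] its values are forced by
   uniqueness, whence continuity there. *)
have [x xmax] := choice (fun p : 'rV[R]_c * 'rV[R]_c => argmax_exists p.1 p.2).
exists x; split.
  move=> p /dom[a [b dp]]; have [_ a0 _ _] := dp.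
  have [uniq xk] := dominant_argmax hv dp; split; last exact/max_rest_lt/xk.
  by apply: unique_argmax_maximizer => // y ymax; exact: uniq.
apply: (argmax_continuous (v := v)) => p /dom[a [b dp]].
have [uniq xk] := dominant_argmax hv dp; have [Sx xm] := xmax p; split=> // y Sy yx.
by apply: uniq => //; split=> // z Sz; rewrite yx; exact: xm.
Qed.

Local Notation V := (v%:R : R).
Local Notation C := (c%:R : R).

(** This supplies the gap [2 v c] of [dominant] when a threshold in one parameter has to outweigh a
    disadvantage [t] in the other. *)
Lemma eta_gap (t E : R) : 0 <= t -> 1 + t <= E -> 2 * V * C <= 2 * V ^+ 2 * C * E - t.
Proof.
move=> t0 tE; have V2 : 2 <= V by rewrite ler_nat.
have C2 : 2 <= C by rewrite ler_nat.
set P := V * C.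
have P4 : 4 <= P by rewrite /P (_ : 4 = 2 * 2 :> R); [exact: ler_pM|ring].
have H1 : P * (1 + t) <= P * E by rewrite ler_wpM2l //; lra.
have H2 : 1 * t <= P * t by rewrite ler_wpM2r //; lra.
have PE0 : 0 <= P * E by rewrite mulr_ge0; lra.
have H3 : 2 * (P * E) <= V * (P * E) by rewrite ler_wpM2r.
have -> : 2 * V ^+ 2 * C * E = 2 * (V * (P * E)) by rewrite /P; ring.
have -> : 2 * V * C = 2 * P by rewrite /P; ring.
move: H1; rewrite mulrDr mulr1; lra.
Qed.

(** Another colour can be ahead only in [h], by at most [t]; hence [a = 0] and [b = t]. The factor
    [expR t] in the threshold compensates [expR b] in [dominant]. *)
Lemma domain_alpha_dominant (p : 'rV[R]_c * 'rV[R]_c) :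
  domain_alpha hc (fun t => 2 * V ^+ 2 * C * expR t) p ->
  exists a b, dominant v p.1 p.2 k a b.
Proof.
have V2 : 2 <= V by rewrite ler_nat.
have C2 : 2 <= C by rewrite ler_nat.
case: p => alpha h [/= a0 dom]; set t := max_all hc h - h 0 k in dom.
have t0 : 0 <= t by rewrite subr_ge0 max_all_ge.
have et := expR_ge1Dx t.
set E := expR t in dom et.
have ar r : r != k -> alpha 0 r <= alpha 0 k - 2 * V ^+ 2 * C * E.
  by move=> rk; have := max_rest_ge alpha rk; lra.
have eta0 : 0 <= 2 * V ^+ 2 * C * E.
  by rewrite !mulr_ge0 ?exprn_ge0 ?expR_ge0 //; lra.
exists 0, t; split=> //.
- move=> r rk; have := ar r rk; have := max_all_ge h r; split.
  + lra.
  + by rewrite /t; lra.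
  + by have := eta_gap t0 et; rewrite /t; lra.
- rewrite addr0 mulr0 addr0.
  (* Nonnegativity of [alpha] at the second colour turns the gap into a lower bound on
     [alpha 0 k]. *)
  have A1 : 2 * V ^+ 2 * C * E <= alpha 0 k by have := ar (color2 hc) isT; have := a0 (color2 hc); lra.
  set A := alpha 0 k in A1 *.
  have A0 : 0 <= A by exact: le_trans A1.
  (* By [A1] the quantity to be absorbed is at most [A^2 / 2], so the quadratic term of the
     exponential suffices. *)
  have F1 : 1 + A ^+ 2 / 2 <= expR (V * A / 2).
    apply: (@le_trans _ _ (expR A)); first exact: (expR_ge1Dxn 1 A0).
    rewrite ler_expR mulrAC -[leLHS]mul1r ler_wpM2r // ler_pdivlMr //; lra.
  rewrite expRB -/E mulrA ltr_pdivrMr ?expR_gt0 // mul1r.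
  apply: lt_le_trans F1.
  have H1 : A * (2 * V ^+ 2 * C * E) <= A * A by rewrite ler_wpM2l.
  have H2 : 0 <= A * V * C * E by rewrite !mulr_ge0 //; lra.
  have -> : A * (v%:R * (v%:R - 1)) * c%:R * E = A * (2 * V ^+ 2 * C * E) / 2 - A * V * C * E.
    by field.
  rewrite expr2; lra.
Qed.

(** Here [alpha_k] may be 0, so [exp(- eta)] has to absorb [exp(v a)] and [1 + a]; as
    [1 + a <= exp a], this explains the exponent [(v + 1) a]. Growth in [alpha_k] is absorbed by
    [exp(v alpha_k / 2)]. *)
Lemma domain_h_dominant (p : 'rV[R]_c * 'rV[R]_c) :
  domain_h hc (fun t => 2 * V ^+ 2 * C * expR ((V + 1) * t)) p ->
  exists a b, dominant v p.1 p.2 k a b.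
Proof.
have V2 : 2 <= V by rewrite ler_nat.
have C2 : 2 <= C by rewrite ler_nat.
case: p => alpha h [/= a0 dom]; set a := max_all hc alpha - alpha 0 k in dom.
have a_0 : 0 <= a by rewrite subr_ge0 max_all_ge.
set eta := (2 * V ^+ 2 * C * expR ((V + 1) * a)) in dom.
have E1 : 1 + a <= expR ((V + 1) * a).
  apply: le_trans (expR_ge1Dx _); rewrite lerD2l -[leLHS]mul1r ler_wpM2r //; lra.
have hr r : r != k -> h 0 r <= h 0 k - eta.
  by move=> rk; have := max_rest_ge h rk; lra.
exists a, (- eta); split=> //.
- move=> r rk; have := hr r rk; have := max_all_ge alpha r; split.
  + by rewrite /a; lra.
  + lra.
  + by have := eta_gap a_0 E1; rewrite -/eta /a; lra.
set X := expR (V * a); set A := alpha 0 k.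
have A0 : 0 <= A by exact: a0.
have X0 : 0 < X by exact: expR_gt0.
have EX : X * (1 + a) <= expR ((V + 1) * a).
  by rewrite mulrDl mul1r expRD ler_wpM2l ?(ltW X0) // expR_ge1Dx.
have F1 : 1 + A <= expR (V * A / 2).
  apply: (@le_trans _ _ (expR A)); first exact: expR_ge1Dx.
  rewrite ler_expR mulrAC -[leLHS]mul1r ler_wpM2r // ler_pdivlMr //; lra.
have F2 : V * (V - 1) * C * X * (1 + a) < expR eta.
  apply: lt_le_trans (expR_ge1Dx _).
  have VC0 : 0 <= V ^+ 2 * C by rewrite mulr_ge0 ?exprn_ge0 //; lra.
  have H1 : V ^+ 2 * C * (X * (1 + a)) <= V ^+ 2 * C * expR ((V + 1) * a) by rewrite ler_wpM2l.
  have H2 : 0 <= V * C * (X * (1 + a)) by rewrite !mulr_ge0 //; lra.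
  have H3 : 0 <= V ^+ 2 * C * expR ((V + 1) * a) by rewrite mulr_ge0 // expR_ge0.
  have -> : V * (V - 1) * C * X * (1 + a) = V ^+ 2 * C * (X * (1 + a)) - V * C * (X * (1 + a)) by ring.
  have -> : eta = 2 * (V ^+ 2 * C * expR ((V + 1) * a)) by rewrite /eta; ring.
  lra.
rewrite expRB [- eta + _]addrC expRB -/X !mulrA ltr_pdivrMr ?expR_gt0 // mul1r ltr_pdivrMr ?expR_gt0 //.
have W0 : 0 <= V * (V - 1) * C * X by rewrite !mulr_ge0 //; lra.
(* The bound [A + a <= (1 + a)(1 + A)] separates the factors controlled by [F2] and [F1]. *)
apply: (@le_lt_trans _ _ (V * (V - 1) * C * X * (1 + a) * (1 + A))).
  rewrite -[leRHS]mulrA (_ : (A + a) * V * (V - 1) * C * X = V * (V - 1) * C * X * (A + a)); last by ring.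
  rewrite ler_wpM2l //; have : 0 <= a * A by rewrite mulr_ge0.
  by rewrite (_ : (1 + a) * (1 + A) = 1 + a + A + a * A); [lra|ring].
have pos : 0 <= V * (V - 1) * C * X * (1 + a) by rewrite mulr_ge0 //; lra.
apply: (@le_lt_trans _ _ (V * (V - 1) * C * X * (1 + a) * expR (V * A / 2))).
  by rewrite ler_wpM2l.
by rewrite [ltRHS]mulrC ltr_pM2r // expR_gt0.
Qed.

End main.

Theorem proposition2p11 (R : realType) (c v : nat)
    (hc : (2 <= c)%N) (hv : (2 <= v)%N) :
  (exists eta : R -> R, (forall t, 0 < eta t) /\
    forall W : v.-tuple (measurableTypeR R) -> R, regular_kernel W ->
      dominant_continuous_maximizer hc W (domain_alpha hc eta)) /\
  (exists eta : R -> R, (forall t, 0 < eta t) /\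
    forall W : v.-tuple (measurableTypeR R) -> R, regular_kernel W ->
      dominant_continuous_maximizer hc W (domain_h hc eta)) /\
  (forall W : v.-tuple (measurableTypeR R) -> R, regular_kernel W ->
    forall alpha h : 'rV[R]_c,
      (forall r, 0 <= alpha 0 r <= (v%:R * (v%:R - 1))^-1) ->
      exists f : R -> 'rV[R]_c, unique_maximizer W alpha h f).
Proof.
have c0 : 0 < c%:R :> R by rewrite ltr0n ltnW.
have v0 : 0 < v%:R :> R by rewrite ltr0n ltnW.
split; last split.
- exists (fun t => 2 * v%:R ^+ 2 * c%:R * expR t); split=> [t|W rW].
    by rewrite !mulr_gt0 // ?exprn_gt0 // expR_gt0.
  by apply: dominant_maximizer => // p; exact: domain_alpha_dominant.
- exists (fun t => 2 * v%:R ^+ 2 * c%:R * expR ((v%:R + 1) * t)); split=> [t|W rW].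
    by rewrite !mulr_gt0 // ?exprn_gt0 // expR_gt0.
  by apply: dominant_maximizer => // p; exact: domain_h_dominant.
move=> W rW alpha h aV; have [x xmax] := argmax_exists (v := v) hc alpha h.
exists (cst x); apply: unique_argmax_maximizer => //.
  by move=> r; case/andP: (aV r).
by move=> y ymax; apply: subcritical_argmax_unique ymax xmax.
Qed.
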